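(* For every $t>1$ and $\tau>2$, with $s=t(\tau-1)$, let $$C_\tau=\{x\in\mathbb R\setminus\mathbb Q:\mu(x)=\tau,\ \mathcal F_{s,t}(x)<\infty\},\qquad E_\tau=\{x\in\mathbb R\setminus\mathbb Q:\mu(x)=\tau,\ \mathcal F_{s,t}(x)=\infty\},$$ where $\mathcal F_{s,t}(x)=\sum_{n\ge1}n^{-s}|\sin(\pi nx)|^{-t}\in[0,\infty]$ and $\mu(x)$ is the irrationality exponent of $x$. Then $$\dim_{\mathcal H}C_\tau=\dim_{\mathcal H}E_\tau=\frac{2}{\tau}=\dim_{\mathcal H}\{x:\mu(x)=\tau\}.$$
   Context: $\dim_{\mathcal H}$ denotes Hausdorff dimension of subsets of $\mathbb R$. For irrational $x$, $\mu(x)=\inf\{\sigma>0: |x-p/q|<q^{-\sigma}\text{ for at most finitely many } p/q\in\mathbb Q\}$; the set $\{x:\mu(x)=\tau\}$ consists of irrational real numbers $x$. *)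

(* Defs.v *)
From HB Require Import structures.
From mathcomp Require Import all_boot all_order all_algebra.
From mathcomp Require Import all_classical all_reals all_analysis.

Set Implicit Arguments.
Unset Strict Implicit.
Unset Printing Implicit Defensive.

Import Order.TTheory GRing.Theory Num.Theory.

Local Open Scope classical_set_scope.
Local Open Scope ring_scope.
Local Open Scope ereal_scope.

(* The diameter of the empty set is -oo, hence it is admissible in every
   delta-cover. *)
Definition diameter (R : realType) (U : set R) : \bar R :=
  ereal_sup [set `|p.1 - p.2|%:E | p in U `*` U].

(* diam(U)^s, with the usual conventions: the empty set costs 0 for every s,
   and for s = 0 every nonempty set costs 1. *)
Definition hausdorff_gauge (R : realType) (s : R) (U : set R) : \bar R :=
  if pselect (U = set0) then 0 else poweR (diameter U) s.

Definition hausdorff_premeasure (R : realType) (s delta : R) (A : set R)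
    : \bar R :=
  ereal_inf [set \sum_(0 <= i <oo) hausdorff_gauge s (U i) |
    U in [set U : (set R)^nat |
      A `<=` \bigcup_i U i /\ forall i, diameter (U i) <= delta%:E]].

Definition hausdorff_measure (R : realType) (s : R) (A : set R) : \bar R :=
  ereal_sup [set hausdorff_premeasure s delta A |
    delta in [set delta : R | (0 < delta)%R]].

Definition hausdorff_dim (R : realType) (A : set R) : \bar R :=
  ereal_inf [set s%:E |
    s in [set s : R | (0 <= s)%R /\ hausdorff_measure s A = 0]].

(* The fractions p/q are counted as rational numbers, with q the reduced
   denominator; since q^(-sigma) decreases with q, using arbitrary
   representations p/q, q >= 1, selects the same rational numbers. The
   exponent is +oo for Liouville numbers. *)
Definition irrationality_exponent (R : realType) (x : R) : \bar R :=
  ereal_inf [set sigma%:E |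
    sigma in [set sigma : R | (0 < sigma)%R /\
      finite_set [set r : rat |
        (`|x - ratr r| < (denq r)%:~R `^ (- sigma))%R]]].

(* All the sines are nonzero for irrational x, the only case in which this
   series is used (for rational x, the convention 0 `^ (- t) = 0 of powR would
   not give the intended value +oo). *)
Definition flint_hills (R : realType) (s t x : R) : \bar R :=
  \sum_(1 <= n <oo) (n%:R `^ (- s) * `|sin (pi * n%:R * x)| `^ (- t))%R%:E.

Definition exact_exponent_set (R : realType) (tau : R) : set R :=
  [set x | irrational x /\ irrationality_exponent x = tau%:E].

Definition convergence_set (R : realType) (s t tau : R) : set R :=
  [set x | [/\ irrational x, irrationality_exponent x = tau%:E
             & flint_hills s t x < +oo]].

Definition divergence_set (R : realType) (s t tau : R) : set R :=
  [set x | [/\ irrational x, irrationality_exponent x = tau%:E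
             & flint_hills s t x = +oo]].

(* Main.v *)
(** The exact exponent set is a limsup set of balls of radius q^(-sigma),
    sigma < tau, around the rationals p/q, and such a set is null in every
    dimension s > 2/sigma.

    For the lower bounds, take a gauge psi and let x be approximable when, for
    some c > 0, c psi(q) <= |x - p/q| for all p/q, and |x - p/q| <= 2 psi(q) for
    infinitely many p/q.  If psi(q) = q^(-tau), the terms of the series at these
    q stay away from 0.  If psi(q) = q^(-tau) (1 + (tau - 1) ln q), then for
    n < 2^(i+1) the signed distances from n x to the nearest integer are
    separated by a constant times i 2^(-i (tau-1)), so the block
    2^i <= n < 2^(i+1) contributes O(i^(-t)) and the series converges.

    For either gauge the approximable points contain the image of a map f
    defined on [0, 1[ with |a - b| <= C |f(a) - f(b)|^d, for any d < 2/tau: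
    inside an interval of length l, one lays a grid of step 8 z^n with
    z = 2^(-1-b), b close to 1, and discards the grid points within 3 z^i of a
    rational with denominator in [2^i, 2^(i+1)), i < n (at most half of them).
    By Dirichlet's theorem each remaining point is close to some p/q with
    2^n <= q <= 2^(bn), and the next interval, of length 2^(-bn tau), is placed
    at p/q + psi(q). *)

Require Import Defs.
From mathcomp Require Import all_boot all_order all_algebra.
From mathcomp Require Import all_classical all_reals all_analysis.
From mathcomp Require Import ring lra zify.

Import Order.TTheory GRing.Theory Num.Theory.
Import numFieldNormedType.Exports.

Local Open Scope classical_set_scope.
Local Open Scope ring_scope.

Set Implicit Arguments.
Unset Strict Implicit.
Unset Printing Implicit Defensive.

(** * Hausdorff measure and dimension *)

Lemma hausdorff_gauge_ge0 {R : realType} (s : R) (U : set R) :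
  (0 <= hausdorff_gauge s U)%E.
Proof. by rewrite /hausdorff_gauge; case: pselect => [?|?] //; exact: poweR_ge0. Qed.

Lemma hausdorff_premeasure_ge0 {R : realType} (s delta : R) (A : set R) :
  (0 <= hausdorff_premeasure s delta A)%E.
Proof.
apply: le_ereal_inf_tmp => _ [U _ <-].
by apply: nneseries_ge0 => i _ _; exact: hausdorff_gauge_ge0.
Qed.

Lemma hausdorff_measure_eq0 {R : realType} (s : R) (A : set R) :
  (forall delta eps : R, 0 < delta -> 0 < eps ->
    exists U : (set R)^nat, [/\ A `<=` \bigcup_i U i,
      forall i, (diameter (U i) <= delta%:E)%E &
      (\sum_(0 <= i <oo) hausdorff_gauge s (U i) <= eps%:E)%E]) ->
  hausdorff_measure s A = 0%E.
Proof.
move=> cover; apply/eqP; rewrite eq_le; apply/andP; split.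
  apply: ge_ereal_sup => _ [delta /= delta0 <-].
  apply/lee_addgt0Pr => e e0; rewrite add0e.
  have [U [AU dU sU]] := cover delta e delta0 e0.
  by apply: le_trans sU; apply: ereal_inf_lbound; exists U.
apply: (@le_trans _ _ (hausdorff_premeasure s 1 A)).
  exact: hausdorff_premeasure_ge0.
by apply: ereal_sup_ubound; exists 1; first exact: ltr01.
Qed.

Lemma diameter_le {R : realType} (U : set R) (r : R) :
  (forall x y, U x -> U y -> `|x - y| <= r) -> (diameter U <= r%:E)%E.
Proof.
by move=> Ur; apply: ge_ereal_sup => _ [[x y] [/= Ux Uy] <-]; rewrite lee_fin Ur.
Qed.

Lemma le_diameter {R : realType} (U : set R) (x y : R) :
  U x -> U y -> (`|x - y|%:E <= diameter U)%E.
Proof. by move=> Ux Uy; apply: ereal_sup_ubound; exists (x, y). Qed.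

Lemma hausdorff_gauge_le {R : realType} (s r : R) (U : set R) :
  0 <= s -> 0 <= r -> (diameter U <= r%:E)%E ->
  (hausdorff_gauge s U <= (r `^ s)%:E)%E.
Proof.
move=> s0 r0 Ur; rewrite /hausdorff_gauge; case: pselect => [?|U0].
  by rewrite lee_fin powR_ge0.
have [x Ux] : exists x, U x by apply/set0P/eqP.
have d0 : (0 <= diameter U)%E.
  by apply: le_trans _ (le_diameter Ux Ux); rewrite subrr normr0.
by rewrite -poweR_EFin; apply: gt0_ler_poweR; rewrite ?in_itv/= ?leey ?andbT.
Qed.

(** This is the convergence half of a Borel-Cantelli argument: every tail of the sequence [U] still
    covers [A], and the tails of a convergent series are small. *)
Lemma hausdorff_measure_limsup_eq0 {R : realType} (s : R) (A : set R)
    (U : (set R)^nat) (rho : R^nat) :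
  0 < s -> (forall n, 0 <= rho n) ->
  (forall n x y, U n x -> U n y -> `|x - y| <= rho n) ->
  (\sum_(0 <= n <oo) (rho n `^ s)%:E < +oo)%E ->
  (forall x, A x -> forall N, exists2 n, (N <= n)%N & U n x) ->
  hausdorff_measure s A = 0%E.
Proof.
move=> s0 rho0 Urho sumfin Alimsup; apply: hausdorff_measure_eq0 => delta e d0 e0.
have f0 n : (0 <= (rho n `^ s)%:E)%E by rewrite lee_fin powR_ge0.
have /= tl := nneseries_tail_cvg sumfin (fun k _ => f0 k).
(* Each term of a tail is at most the whole tail, so a tail below delta^s also forces all its
   diameters below [delta]. *)
have m0 : 0 < Num.min e (delta `^ s) by rewrite lt_min e0 powR_gt0.
move/fine_cvgP : tl => [tlfin /cvgrPdist_lt /(_ _ m0) tl].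
have [N /= _ NP] : \forall N \near \oo,
    (\sum_(N <= k <oo) (rho k `^ s)%:E < (Num.min e (delta `^ s))%:E)%E.
  near=> N.
  have fN : (\sum_(N <= k <oo) (rho k `^ s)%:E)%E \is a fin_num by near: N.
  rewrite -(fineK fN) lte_fin; apply: le_lt_trans (ler_norm _) _.
  by rewrite -normrN -sub0r; near: N.
have {}NP := NP N (leqnn N).
have tailE : (\sum_(N <= k <oo) (rho k `^ s)%:E =
    \sum_(0 <= k <oo) (rho (k + N)%N `^ s)%:E)%E.
  by rewrite (nneseries_addn (f := fun k => (rho k `^ s)%:E)).
have dle n : (diameter (U (n + N)%N) <= (rho (n + N)%N)%:E)%E.
  by apply: diameter_le => x y; exact: Urho.
exists (fun n => U (n + N)%N); split.
- move=> x /Alimsup /(_ N)[n Nn Ux]; exists (n - N)%N => //=.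
  by rewrite subnK.
- move=> n; apply: le_trans (dle n) _; rewrite lee_fin.
  have : ((rho (n + N)%N `^ s)%:E < (Num.min e (delta `^ s))%:E)%E.
    apply: le_lt_trans NP; rewrite tailE.
    apply: le_trans (nneseries_lim_ge n.+1 _); last by move=> *; exact: f0.
    rewrite big_nat_recr//=; apply: leeDr.
    by apply: sume_ge0 => i _; exact: f0.
  rewrite lte_fin lt_min => /andP[_]; apply: contraLR; rewrite -ltNge -leNgt.
  by move=> /ltW h; apply: ge0_ler_powR; rewrite ?nnegrE ?(ltW s0)// ltW.
- apply: (@le_trans _ _ (Num.min e (delta `^ s))%:E); last by rewrite lee_fin ge_min lexx.
  apply: le_trans (ltW NP); rewrite tailE; apply: lee_nneseries => [i _ _|i _].
    exact: hausdorff_gauge_ge0.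
  by apply: hausdorff_gauge_le; rewrite ?(ltW s0)// dle.
Unshelve. all: by end_near. Qed.

(* Pulling a cover of A back along f gives a cover of [0, 1[ by intervals of
   length at most 2 C diam^d, to which countable subadditivity of the Lebesgue
   measure applies. *)
Lemma hausdorff_measure_holder {R : realType} (d C : R) (A : set R) (f : R -> R) :
  0 <= d -> 0 < C -> (forall a : R, 0 <= a < 1 -> A (f a)) ->
  (forall a b : R, 0 <= a < 1 -> 0 <= b < 1 -> `|a - b| <= C * `|f a - f b| `^ d) ->
  hausdorff_measure d A != 0%E.
Proof.
move=> d0 C0 fA fC.
suff: ((2 * C)^-1%:E <= hausdorff_measure d A)%E.
  by apply: contraTneq => ->; rewrite -ltNge lte_fin invr_gt0 mulr_gt0.
apply: (@le_trans _ _ (hausdorff_premeasure d 1 A)); last first.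
  by apply: ereal_sup_ubound; exists 1; first exact: ltr01.
apply: le_ereal_inf_tmp => _ [U [AU dU] <-].
pose P i := [set a : R | 0 <= a < 1 /\ U i (f a)].
pose L i := C * fine (hausdorff_gauge d (U i)).
have gfin i : hausdorff_gauge d (U i) \is a fin_num.
  rewrite ge0_fin_numE ?hausdorff_gauge_ge0//.
  by apply: le_lt_trans (hausdorff_gauge_le d0 ler01 (dU i)) _; rewrite ltry.
have L0 i : 0 <= L i by apply: mulr_ge0; [exact: ltW|exact/fine_ge0/hausdorff_gauge_ge0].
(* The preimage [P i] may fail to be measurable; it is replaced by an interval around one of its
   points. *)
pose I i : set R := if pselect (exists a, P i a) is left h then
   `[projT1 (cid h) - L i, projT1 (cid h) + L i]%classic else set0.
have mI i : measurable (I i) by rewrite /I; case: pselect.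
have PI i : P i `<=` I i.
  move=> b [b01 Ub]; rewrite /I; case: pselect => [h|]; last first.
    by case; exists b.
  case: cid => a [a01 Ua] /=; rewrite in_itv/= -ler_distlC.
  rewrite distrC; apply: le_trans (fC _ _ b01 a01) _; rewrite ler_pM2l//.
  have Ug : hausdorff_gauge d (U i) = poweR (diameter (U i)) d.
    by rewrite /hausdorff_gauge; case: pselect => // U0; exfalso; move: Ua; rewrite U0.
  rewrite -lee_fin fineK// Ug -poweR_EFin; apply: gt0_ler_poweR => //;
    rewrite ?in_itv/= ?leey ?andbT ?lee_fin//.
    by apply: le_trans _ (le_diameter Ua Ua); rewrite subrr normr0.
  exact: le_diameter.
have lI i : (lebesgue_measure (I i) <= (2 * C)%:E * hausdorff_gauge d (U i))%E.
  rewrite -(fineK (gfin i)) -EFinM /I; case: pselect => [h|?].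
    rewrite lebesgue_measure_itv/= lte_fin; case: ifPn => _.
      rewrite -EFinD lee_fin [leRHS](_ : _ = L i + L i); last by rewrite /L; ring.
      have /(_ _ (L i)) h2 : forall x y : R, x + y - (x - y) <= y + y by move=> *; lra.
      exact: h2.
    by rewrite lee_fin -mulrA; apply: mulr_ge0 => //; exact: L0.
  by rewrite measure0 lee_fin -mulrA; apply: mulr_ge0 => //; exact: L0.
have : (lebesgue_measure (`[0%R, 1%R[%classic : set R) <=
        \sum_(0 <= i <oo) lebesgue_measure (I i))%E.
  apply: measure_sigma_subadditive => //.
  move=> a /=; rewrite in_itv/= => a01.
  have [i _ Ui] := AU _ (fA _ a01).
  by exists i => //; apply: PI; split.
rewrite lebesgue_measure_itv/= lte_fin ltr01 oppr0 adde0 => h.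
rewrite -(@lee_pmul2l _ (2 * C)%:E)// ?lte_fin ?mulr_gt0//.
rewrite -EFinM divff ?gt_eqF ?mulr_gt0//.
apply: le_trans h _.
rewrite -nneseriesZl; last by move=> i _; exact: hausdorff_gauge_ge0.
apply: lee_nneseries => [i _ _|i _]; first exact: measure_ge0.
exact: lI.
Qed.

Lemma hausdorff_dim_le {R : realType} (D : R) (A : set R) : 0 <= D ->
  (forall s, D < s -> hausdorff_measure s A = 0%E) ->
  (hausdorff_dim A <= D%:E)%E.
Proof.
move=> D0 nullA; apply/lee_addgt0Pr => e e0.
apply: ereal_inf_lbound; exists (D + e) => //; split; first by rewrite addr_ge0// ltW.
by apply: nullA; rewrite ltrDl.
Qed.

(** Given s < D of measure zero, the map is taken for d halfway between s and D, hence positive even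
    if s = 0. Since f takes values in [0, 1], distances are at most 1 and the exponent d can be
    lowered to s. *)
Lemma hausdorff_dim_ge {R : realType} (D : R) (A : set R) :
  (forall d, 0 < d -> d < D -> exists f : R -> R, exists C : R,
    [/\ 0 < C, forall a, 0 <= a < 1 -> A (f a) /\ 0 <= f a <= 1 &
    forall a b, 0 <= a < 1 -> 0 <= b < 1 ->
      `|a - b| <= C * `|f a - f b| `^ d]) ->
  (D%:E <= hausdorff_dim A)%E.
Proof.
move=> holder; apply: le_ereal_inf_tmp => _ [s [s0 sA0] <-].
rewrite lee_fin leNgt; apply/negP => sD.
pose d := (s + D) / 2.
have [||f [C [C0 fA fC]]] := holder d; [rewrite /d; lra..|].
suff : hausdorff_measure s A != 0%E by rewrite sA0 eqxx.
apply: (@hausdorff_measure_holder _ _ C _ f) => // [a /fA[]//|a b a01 b01].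
apply: le_trans (fC _ _ a01 b01) _; rewrite ler_pM2l//.
have [_ fa] := fA _ a01; have [_ fb] := fA _ b01.
have [->|fab] := eqVneq (f a) (f b).
  rewrite subrr normr0 powR0; first exact: powR_ge0.
  by rewrite /d; lra.
apply: ger_powR; last by rewrite /d; lra.
by rewrite normr_gt0 subr_eq0 fab/= ler_norml; lra.
Qed.

Lemma hausdorff_measure_subset0 {R : realType} (s : R) (A B : set R) :
  A `<=` B -> hausdorff_measure s B = 0%E -> hausdorff_measure s A = 0%E.
Proof.
move=> AB B0; apply/eqP; rewrite eq_le; apply/andP; split.
  rewrite -B0; apply: ge_ereal_sup => _ [delta /= d0 <-].
  apply: (@le_trans _ _ (hausdorff_premeasure s delta B)).
    apply: ereal_inf_le_tmp => _ [U [BU dU] <-].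
    by exists U => //; split => //; exact: subset_trans BU.
  by apply: ereal_sup_ubound; exists delta.
apply: (@le_trans _ _ (hausdorff_premeasure s 1 A)).
  exact: hausdorff_premeasure_ge0.
by apply: ereal_sup_ubound; exists 1; first exact: ltr01.
Qed.

(** * Rational approximation and the irrationality exponent *)

Definition rden (r : rat) : nat := `|denq r|%N.

Lemma rden_gt0 (r : rat) : (0 < rden r)%N.
Proof. by rewrite /rden absz_gt0 denq_neq0. Qed.

Lemma denq_rden (R : pzRingType) (r : rat) : (denq r)%:~R = (rden r)%:R :> R.
Proof. by rewrite -[in LHS](gez0_abs (ltW (denq_gt0 r))) -pmulrn. Qed.

Lemma rden_gt0R (R : realType) (r : rat) : 0 < (rden r)%:R :> R.
Proof. by rewrite ltr0n rden_gt0. Qed.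

Lemma ratr_num_den (R : realType) (r : rat) :
  ratr r = (numq r)%:~R / (rden r)%:R :> R.
Proof. by rewrite -denq_rden. Qed.

Lemma numq_ratr (R : realType) (r : rat) :
  (numq r)%:~R = (rden r)%:R * ratr r :> R.
Proof. by rewrite ratr_num_den mulrC divfK// gt_eqF// rden_gt0R. Qed.

Lemma rden_dist (R : realType) (r r' : rat) : r != r' ->
  ((rden r)%:R * (rden r')%:R)^-1 <= `|ratr r - ratr r'| :> R.
Proof.
move=> rr'; have d0 := rden_gt0R R r; have d0' := rden_gt0R R r'.
rewrite -[leRHS](@mulfK _ ((rden r)%:R * (rden r')%:R)) ?mulf_neq0 ?gt_eqF//.
apply: ler_peMl; first by rewrite invr_ge0 mulr_ge0 ?ltW.
rewrite -[X in `|_| * X]gtr0_norm ?mulr_gt0// -normrM mulrBl.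
rewrite mulrA [ratr r * _]mulrC -numq_ratr.
rewrite [X in _ - X]mulrCA [ratr r' * _]mulrC -numq_ratr.
rewrite -!denq_rden -!intrM -intrB -intr_norm.
rewrite ler1z -gtz0_ge1 normr_gt0 subr_eq0.
apply: contra rr' => /eqP h; rewrite -(divq_num_den r) -(divq_num_den r').
by rewrite eqr_div ?intr_eq0 ?denq_neq0// -!intrM h mulrC.
Qed.

Lemma finite_rden_le (R : realType) (K : nat) (M : R) :
  finite_set [set r : rat | (rden r <= K)%N /\ `|ratr r : R| <= M].
Proof.
pose N := Num.truncn (K%:R * M : R).
pose g (u : nat * nat * bool) : rat := (-1) ^+ u.2 * u.1.1%:R / u.1.2%:R.
apply: (@sub_finite_set _ _ (g @` (`I_N.+1 `*` `I_K.+1 `*` [set: bool]))); last first.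
  by apply: finite_image; apply: finite_setX => //; exact: finite_setX.
move=> r [/= rK rM]; exists (`|numq r|%N, rden r, numq r < 0) => /=; last first.
  rewrite /g/= -denq_rden -[RHS]divq_num_den; congr (_ / _).
  by rewrite [in RHS](intEsign (numq r)) rmorphM/= rmorph_sign.
split=> //; split => //=; rewrite ?ltnS//.
rewrite /N; have KM : 0 <= K%:R * M by apply: mulr_ge0 => //; exact: le_trans rM.
rewrite truncn_ge_nat// natr_absz intr_norm numq_ratr normrM.
by rewrite gtr0_norm ?rden_gt0R// ler_pM// ler_nat.
Qed.

Lemma finite_rat_bounded (A : set rat) : finite_set A ->
  exists N, forall r, A r -> (rden r < N)%N.
Proof.
move=> /finite_seqP[s ->]; exists (\max_(r <- s) rden r).+1 => r /= rs.
by rewrite ltnS; apply: (leq_bigmax_seq r).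
Qed.

Definition approximable (R : realType) (psi : nat -> R) : set R :=
  [set x | (exists2 c, 0 < c & forall r : rat, c * psi (rden r) <= `|x - ratr r|) /\
    forall N, exists2 r : rat, (N <= rden r)%N &
      `|x - ratr r| <= 2 * psi (rden r)].

(** The lower bound excludes rational x and, compared with q^(-tau-e), leaves only finitely many
    denominators. The infinitely many good fractions rule out every exponent sigma < tau, because 2
    psi(q) < q^(-sigma) for large q. *)
Lemma approximable_exact (R : realType) (psi : nat -> R) (tau x : R) :
  0 < tau ->
  (forall q, (0 < q)%N -> q%:R `^ (- tau) <= psi q) ->
  (forall sigma, sigma < tau -> exists N, forall q, (N <= q)%N ->
     2 * psi q < q%:R `^ (- sigma)) ->
  approximable psi x -> exact_exponent_set tau x.
Proof.
move=> tau0 psi_ge psi_lt [[c c0 xc] xN].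
have psi0 r : 0 < psi (rden r).
  by apply: lt_le_trans (psi_ge _ (rden_gt0 r)); rewrite powR_gt0// rden_gt0R.
split.
  move=> [r _ rx]; have := xc r; rewrite rx subrr normr0 leNgt => /negP; apply.
  exact: mulr_gt0.
apply/eqP; rewrite eq_le; apply/andP; split.
  apply/lee_addgt0Pr => e e0; apply: ereal_inf_lbound; exists (tau + e) => //.
  split; first exact: addr_gt0.
  (* From c q^(-tau) < q^(-tau-e) follows q^e < 1/c, so [K] bounds the denominators. *)
  pose K := Num.truncn (c^-1 `^ e^-1).
  apply: sub_finite_set (@finite_rden_le R K (`|x| + 1)) => r /= rx.
  have q0 := rden_gt0R R r; have q1 : 1 <= (rden r)%:R :> R.
    by rewrite ler1n rden_gt0.
  rewrite denq_rden in rx; split.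
    rewrite truncn_ge_nat ?powR_ge0//.
    have h : (rden r)%:R `^ e < c^-1.
      have : c * (rden r)%:R `^ (- tau) < (rden r)%:R `^ (- (tau + e)).
        apply: le_lt_trans rx; apply: le_trans (xc r).
        by rewrite ler_pM2l// psi_ge// rden_gt0.
      rewrite opprD powRD; last by rewrite (gt_eqF q0) implybT.
      rewrite mulrC ltr_pM2l ?powR_gt0// powRN.
      rewrite -[in X in _ -> X](invrK (_ `^ e)) ltf_pV2 ?posrE ?invr_gt0 ?powR_gt0//.
    rewrite -[leLHS]powRr1 ?(ltW q0)// -[X in _ `^ X](@divff _ e) ?gt_eqF// powRrM.
    by apply: ge0_ler_powR; rewrite ?nnegrE ?invr_ge0 ?powR_ge0// ltW.
  have : `|x - ratr r| <= 1.
    apply: le_trans (ltW rx) _; rewrite powRN invf_le1 ?powR_gt0//.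
    by rewrite -[leLHS](powRr0 (rden r)%:R) ler_powR// addr_ge0// ltW.
  by have := ler_distD x (ratr r) 0; rewrite !subr0 distrC; lra.
apply: le_ereal_inf_tmp => _ [sigma [s0 fin] <-]; rewrite lee_fin leNgt.
apply/negP => st.
have [N NP] := psi_lt _ st.
have [M MP] := finite_rat_bounded fin.
have [r rNM rx] := xN (maxn M N).
have := MP r; rewrite ltnNge (leq_trans _ rNM) ?leq_maxl//= => h.
suff : false by [].
apply: h; rewrite denq_rden; apply: le_lt_trans rx _.
by apply: NP; apply: leq_trans rNM; exact: leq_maxr.
Qed.

(** Otherwise the fractions in question would have bounded denominators and lie within 1 of x, hence
    be finite in number, and sigma would be admissible in the infimum. *)
Lemma exact_infinitely_often (R : realType) (tau sigma x : R) :
  0 < sigma -> sigma < tau -> exact_exponent_set tau x -> forall N,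
  exists2 r : rat, (N <= rden r)%N & `|x - ratr r| < (rden r)%:R `^ (- sigma).
Proof.
move=> s0 st [_ xtau] N; apply: contrapT => nex.
suff : (irrationality_exponent x <= sigma%:E)%E by rewrite xtau lee_fin leNgt st.
apply: ereal_inf_lbound; exists sigma => //; split => //.
apply: sub_finite_set (@finite_rden_le R N (`|x| + 1)) => r /=.
rewrite denq_rden => rx; split.
  by rewrite leqNgt; apply/negP => /ltnW Nr; apply: nex; exists r.
have q0 := rden_gt0R R r; have q1 : 1 <= (rden r)%:R :> R.
  by rewrite ler1n rden_gt0.
have : `|x - ratr r| <= 1.
  apply: le_trans (ltW rx) _; rewrite powRN invf_le1 ?powR_gt0//.
  by rewrite -[leLHS](powRr0 (rden r)%:R) ler_powR// ltW.
by have := ler_distD x (ratr r) 0; rewrite !subr0 distrC; lra.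
Qed.

(** * The series *)

(** A telescoping substitute for the integral test. With a = k + 2 it reduces to (1 - 1/a)^(1-theta)
    >= 1 + (theta-1)/a, which follows from e^u >= 1 + u and ln(1 - 1/a) <= -1/a. *)
Lemma powR_nat_sum_step (R : realType) (theta : R) (k : nat) : 1 < theta ->
  k.+2%:R `^ (- theta) <=
    (theta - 1)^-1 * (k.+1%:R `^ (1 - theta) - k.+2%:R `^ (1 - theta)).
Proof.
move=> t1; have t0 : 0 < theta - 1 by rewrite subr_gt0.
have a0 : 0 < k.+2%:R :> R by []; have b0 : 0 < k.+1%:R :> R by [].
rewrite ler_pdivlMl// (_ : 1 - theta = - theta + 1); last by rewrite addrC.
set a : R := k.+2%:R in a0 *; set b : R := k.+1%:R in b0 *.
have ba : b = a * (1 - a^-1).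
  by rewrite mulrBr mulr1 divff ?gt_eqF// /a -natr1 addrK.
have a1 : 0 < 1 - a^-1 by rewrite -(pmulr_rgt0 _ a0) -ba.
rewrite {1}ba powRM ?(ltW a0) ?(ltW a1)//.
rewrite -[leLHS]mulr1 [a `^ (- theta + 1)]powRD; last by rewrite (gt_eqF a0) implybT.
rewrite powRr1 ?(ltW a0)//.
have -> : a `^ (- theta) * a * (1 - a^-1) `^ (- theta + 1) - a `^ (- theta) * a =
  a `^ (- theta) * (a * ((1 - a^-1) `^ (- theta + 1) - 1)) by ring.
rewrite mulr1 mulrC ler_pM2l ?powR_gt0//.
rewrite -ler_pdivrMl// lerBrDl /powR gt_eqF//.
apply: le_trans (expR_ge1Dx _); rewrite lerD2l.
have -> : (- theta + 1) * ln (1 - a^-1) = (- ln (1 - a^-1)) * (theta - 1) by ring.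
rewrite ler_pM2r// lerNr; apply: le_ln1Dx.
by rewrite ltrN2 -subr_gt0.
Qed.

Lemma powR_nat_sum_le (R : realType) (theta : R) (n : nat) : 1 < theta ->
  \sum_(1 <= k < n) k%:R `^ (- theta) <= 1 + (theta - 1)^-1.
Proof.
move=> t1; have t0 : 0 < theta - 1 by rewrite subr_gt0.
suff h m : \sum_(1 <= k < m.+2) k%:R `^ (- theta) <=
    1 + (theta - 1)^-1 * (1 - m.+1%:R `^ (1 - theta)).
  have B0 : 0 <= 1 + (theta - 1)^-1 by rewrite addr_ge0// invr_ge0 ltW.
  case: n => [|[|m]]; [by rewrite big_geq|by rewrite big_geq|].
  apply: le_trans (h m) _; rewrite lerD2l.
  apply: ler_piMr; first by rewrite invr_ge0 ltW.
  by rewrite lerBlDr lerDl powR_ge0.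
elim: m => [|m IH]; first by rewrite big_nat1 powR1 subrr mulr0 addr0.
rewrite big_nat_recr//=.
by apply: le_trans (lerD IH (powR_nat_sum_step m t1)) _; rewrite le_eqVlt; apply/orP; left; apply/eqP; ring.
Qed.

Lemma nneseries_le_partial (R : realType) (f : nat -> R) (m : nat) (B : R) :
  (forall n, 0 <= f n) -> (forall n, \sum_(m <= k < n) f k <= B) ->
  (\sum_(m <= k <oo) (f k)%:E <= B%:E)%E.
Proof.
move=> f0 fB; apply: lime_le.
  by apply: is_cvg_nneseries => n _ _; rewrite lee_fin.
by apply: nearW => n; rewrite sumEFin lee_fin.
Qed.

Lemma powR_nneseries_lty (R : realType) (theta : R) : 1 < theta ->
  (\sum_(0 <= k <oo) (k.+1%:R `^ (- theta))%:E < +oo)%E.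
Proof.
move=> t1; apply: (@le_lt_trans _ _ (1 + (theta - 1)^-1)%:E); last exact: ltry.
apply: nneseries_le_partial => n; first exact: powR_ge0.
have := powR_nat_sum_le n.+1 t1.
by rewrite big_add1.
Qed.

(** * The sine and the distance to the nearest integer *)

Lemma normr_sinBpiz (R : realType) (y : R) (p : int) :
  `|sin (y - pi * p%:~R)| = `|sin y|.
Proof.
have hn (n : nat) z : `|sin (z + pi * n%:R)| = `|sin z| :> R.
  elim: n => [|n IH]; first by rewrite mulr0 addr0.
  by rewrite -natr1 mulrDr mulr1 addrA sinDpi normrN.
case: p => n; last by rewrite NegzE mulrNz mulrN opprK; exact: hn.
by rewrite -[in RHS](subrK (pi * n%:~R) y) hn.
Qed.

Lemma normr_sin_le (R : realType) (y : R) : `|sin y| <= `|y|.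
Proof.
wlog y0 : y / 0 <= y => [H|].
  have [/H//|/ltW y0] := leP 0 y.
  by have := H (- y); rewrite sinN !normrN oppr_ge0; exact.
move: y0; rewrite le_eqVlt => /orP[/eqP<-|y0]; first by rewrite sin0 normr0.
have [|c _ E] := @MVT R sin cos 0 y y0 (fun z _ => is_derive_sin z).
  by apply: continuous_subspaceT; exact: continuous_sin.
move: E; rewrite sin0 !subr0 => ->; rewrite normrM ler_piMl//; exact: cos_max.
Qed.

(** With y = pi d / 2 <= pi/4, sin(pi d) = 2 sin y cos y, and sin y = y cos c for some c between 0
    and y. Both cosines are at least cos(pi/4), whose square is at least 1/2, and d <= y because pi
    >= 2. *)
Lemma ler_sin_pi (R : realType) (d : R) : 0 <= d <= 2^-1 -> d <= sin (pi * d).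
Proof.
move=> /andP[d0 d12]; have pi2 : 2 <= pi :> R by exact: pi_ge2.
move: d0; rewrite le_eqVlt => /orP[/eqP<-|d0]; first by rewrite mulr0 sin0.
pose y : R := pi * d / 2.
have y0 : 0 < y by rewrite /y !mulr_gt0// pi_gt0.
have ypi : y <= pi / 4 by rewrite /y; have := @pi_gt0 R; nra.
have cpi4 : 2^-1 <= cos (pi / 4) ^+ 2 :> R.
  have := @cos_mulr2n R (pi / 4).
  rewrite (_ : pi / 4 *+ 2 = pi / 2 :> R); last by rewrite mulr2n; lra.
  by rewrite cos_pihalf; lra.
have cosy c : 0 <= c -> c <= y -> cos (pi / 4) <= cos c.
  move=> c0 cy; rewrite leNgt; apply/negP => h.
  have p0 := @pi_gt0 R.
  have E := @ltr_cos R (pi / 4) c; rewrite !in_itv/= h in E.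
  have : true = (pi / 4 < c) by apply: E; lra.
  by move=> /esym; lra.
have c40 : 0 <= cos (pi / 4) :> R.
  by apply: cos_ge0_pihalf; have := @pi_gt0 R; lra.
have [|c cy E] := @MVT R sin cos 0 y y0 (fun z _ => is_derive_sin z).
  by apply: continuous_subspaceT; exact: continuous_sin.
move: cy; rewrite in_itv/= => /andP[c0 cy].
have -> : pi * d = y *+ 2 by rewrite /y mulr2n; lra.
rewrite sin_mulr2n; move: E; rewrite sin0 !subr0 => ->.
have := cosy c (ltW c0) (ltW cy); have := cosy y (ltW y0) (lexx y).
set a := cos (pi / 4) in cpi4 c40 *; set u := cos y; set v := cos c => ua va.
have uv : 2^-1 <= u * v by apply: le_trans cpi4 _; rewrite expr2 ler_pM.
have dy : d <= y by rewrite /y; nra.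
rewrite mulrA mulr2n; nra.
Qed.

Lemma ex_nearest_int (R : realType) (y : R) :
  exists p : int, `|y - p%:~R| <= 2^-1.
Proof.
exists (Num.floor (y + 2^-1)); have := floor_itv (y + 2^-1).
by rewrite intrD ler_norml => /andP[]; rewrite (_ : 1%:~R = 1 :> R)//; lra.
Qed.

Lemma normr_sin_pi_ge (R : realType) (y : R) (p : int) :
  `|y - p%:~R| <= 2^-1 -> `|y - p%:~R| <= `|sin (pi * y)|.
Proof.
move=> yp; rewrite -(normr_sinBpiz _ p) -mulrBr.
set z := y - _ in yp *.
wlog z0 : z yp / 0 <= z => [H|].
  have [/(H _ yp)//|/ltW z0] := leP 0 z.
  by have := H (- z); rewrite mulrN sinN !normrN oppr_ge0; exact.
rewrite ger0_norm// in yp *; apply: le_trans (ler_norm _).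
by apply: ler_sin_pi; rewrite z0.
Qed.

Lemma normr_sin_pi_le (R : realType) (y : R) (p : int) :
  `|sin (pi * y)| <= pi * `|y - p%:~R|.
Proof.
rewrite -(normr_sinBpiz _ p) -mulrBr; apply: le_trans (normr_sin_le _) _.
by rewrite normrM (ger0_norm (pi_ge0 _)).
Qed.

Lemma irrational_natmul_neq (R : realType) (x : R) (n : nat) (p : int) :
  irrational x -> (0 < n)%N -> 0 < `|n%:R * x - p%:~R|.
Proof.
move=> xirr n0; rewrite normr_gt0 subr_eq0; apply/negP => /eqP nxp; apply: xirr.
by apply/rationalP; exists p, n; rewrite -nxp mulrC mulKf// pnatr_eq0 -lt0n.
Qed.

Lemma normr_sin_pi_gt0 (R : realType) (x : R) (n : nat) :
  irrational x -> (0 < n)%N -> 0 < `|sin (pi * n%:R * x)|.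
Proof.
move=> xirr n0; have [p np] := ex_nearest_int (n%:R * x).
rewrite -mulrA; apply: lt_le_trans (normr_sin_pi_ge np).
exact: irrational_natmul_neq.
Qed.

Lemma flint_hills_pinfty (R : realType) (s t x kappa : R) : 0 < kappa ->
  (forall N, exists2 n, (N <= n)%N &
     kappa <= n%:R `^ (- s) * `|sin (pi * n%:R * x)| `^ (- t)) ->
  flint_hills s t x = +oo%E.
Proof.
move=> k0 large; apply/eqP; rewrite eq_le leey/= leNgt; apply/negP => fin.
pose f n := (n%:R `^ (- s) * `|sin (pi * n%:R * x)| `^ (- t))%:E : \bar R.
have f0 n : (0 <= f n)%E by rewrite lee_fin mulr_ge0 ?powR_ge0.
have fin' : (\sum_(0 <= k <oo | (1 <= k)%N) f k < +oo)%E.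
  by rewrite -[X in (X < _)%E](eseries_cond f xpredT 1).
have /= /fine_cvgP[tlfin /cvgrPdist_lt /(_ _ k0) tl] :=
  nneseries_tail_cvg fin' (fun k _ => f0 k).
have [N /= _ NP] : \forall N \near \oo,
    (\sum_(N <= k <oo | (1 <= k)%N) f k < kappa%:E)%E.
  near=> N.
  have fN : (\sum_(N <= k <oo | (1 <= k)%N) f k)%E \is a fin_num by near: N.
  rewrite -(fineK fN) lte_fin; apply: le_lt_trans (ler_norm _) _.
  by rewrite -normrN -sub0r; near: N.
have [n Nn kn] := large N.+1.
have := NP N (leqnn N); rewrite ltNge => /negP; apply.
apply: (@le_trans _ _ (f n)); first by rewrite lee_fin.
apply: le_trans (nneseries_lim_ge n.+1 _); last by move=> *; exact: f0.
rewrite big_mkcond big_nat_recr/=; last exact: ltnW.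
rewrite (leq_trans _ Nn)//; apply: leeDr.
by apply: sume_ge0 => i _; case: ifP => // _; exact: f0.
Unshelve. all: by end_near. Qed.

(** At a good denominator q, |sin(pi q x)| <= 2 pi q^(1-tau). The exponent t (tau - 1) is the one
    for which the powers of q cancel, so that the term of index q is at least (2 pi)^(-t). *)
Lemma flint_hills_approximable_pinfty (R : realType) (tau t x : R) :
  1 < t -> 1 < tau -> irrational x ->
  approximable (fun q => q%:R `^ (- tau)) x ->
  flint_hills (t * (tau - 1)) t x = +oo%E.
Proof.
move=> t1 tau1 xirr [_ xN].
have pi0 := @pi_gt0 R; have t0 : 0 < t by lra.
apply: (@flint_hills_pinfty _ _ _ _ ((2 * pi) `^ (- t))).
  by rewrite powR_gt0 ?mulr_gt0.
move=> N; have [r rN rx] := xN N; exists (rden r) => //.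
have q0 := rden_gt0R R r; set q := (rden r)%:R in q0 rx *.
have sin0 := normr_sin_pi_gt0 xirr (rden_gt0 r).
have sinle : `|sin (pi * q * x)| <= (2 * pi) * q `^ (1 - tau).
  rewrite -mulrA; apply: le_trans (normr_sin_pi_le (q * x) (numq r)) _.
  rewrite numq_ratr -mulrBr normrM (gtr0_norm q0).
  apply: (@le_trans _ _ (pi * (q * (2 * q `^ (- tau))))); first by rewrite !ler_pM2l.
  rewrite powRD; last by rewrite (gt_eqF q0) implybT.
  by rewrite powRr1 ?(ltW q0)// le_eqVlt; apply/orP; left; apply/eqP; ring.
have -> : q `^ (- (t * (tau - 1))) = (q `^ (1 - tau)) `^ t.
  by rewrite -powRrM; congr (_ `^ _); ring.
have pi20 : 0 < 2 * pi :> R by rewrite mulr_gt0.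
rewrite !powRN ler_pdivlMr ?powR_gt0// mulrC ler_pdivrMr ?powR_gt0//.
rewrite -powRM ?powR_ge0 ?(ltW pi20)//.
by apply: ge0_ler_powR; rewrite ?nnegrE ?mulr_ge0 ?powR_ge0 ?(ltW pi0) ?(ltW t0)// [leRHS]mulrC.
Qed.

(** * Convergence of the series for the logarithmic gauge *)

Lemma uniq_sum_le_nat (R : realType) (F : nat -> R) (l : seq nat) :
  (forall k, 0 <= F k) -> uniq l -> all (leq 1) l ->
  exists K, \sum_(k <- l) F k <= \sum_(1 <= k < K) F k.
Proof.
move=> F0 ul l1; exists (\max_(k <- l) k).+1.
rewrite (perm_big [seq k <- index_iota 1 (\max_(k <- l) k).+1 | k \in l]) /=.
  rewrite big_filter big_mkcond/=; apply: ler_sum => k _; case: ifP => // _.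
apply: uniq_perm => //; first by rewrite filter_uniq// iota_uniq.
move=> k; rewrite mem_filter mem_index_iota; case kl: (k \in l) => //=.
by rewrite (allP l1 _ kl)/= ltnS; apply/esym; apply: (leq_bigmax_seq k).
Qed.

(** The integer parts of d n / delta are distinct positive integers, so the sum is at most
    delta^(-t) times a partial sum of the series of k^(-t). *)
Lemma separated_sum_pos (R : realType) (t delta : R) (s : seq nat) (d : nat -> R) :
  1 < t -> 0 < delta -> uniq s -> {in s, forall n, delta <= d n} ->
  {in s &, forall n m, n != m -> delta <= `|d n - d m|} ->
  \sum_(n <- s) d n `^ (- t) <= (1 + (t - 1)^-1) * delta `^ (- t).
Proof.
move=> t1 de0 us ds sep; have t0 : 0 < t by lra.
pose g n := Num.truncn (d n / delta).
have gd n : n \in s -> (g n)%:R <= d n / delta < (g n).+1%:R.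
  move=> ns; apply: truncn_itv; rewrite divr_ge0 ?(ltW de0)//.
  by apply: le_trans (ds _ ns); exact: ltW.
have g1 n : n \in s -> (1 <= g n)%N.
  by move=> ns; rewrite /g truncn_gt0 ler_pdivlMr// mul1r ds.
have ginj : {in s &, injective g}.
  move=> n m ns ms gnm; apply/eqP; apply/negPn/negP => nm.
  have := sep _ _ ns ms nm; rewrite leNgt => /negP; apply.
  have := gd _ ns; have := gd _ ms; rewrite gnm -natr1 => /andP[a1 a2] /andP[b1 b2].
  rewrite -[ltRHS]mul1r -ltr_pdivrMr// -[X in _ / X](gtr0_norm de0) -normf_div mulrBl.
  by rewrite ltr_norml; lra.
have -> : (1 + (t - 1)^-1) * delta `^ (- t) = delta `^ (- t) * (1 + (t - 1)^-1).
  by rewrite mulrC.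
have um : uniq (map g s) by rewrite map_inj_in_uniq.
have am : all (leq 1) (map g s).
  by apply/allP => _ /mapP[n ns ->]; exact: g1.
have [K KP] := @uniq_sum_le_nat R (fun k => k%:R `^ (- t)) _
  (fun k => powR_ge0 _ _) um am.
apply: le_trans (_ : delta `^ (- t) * \sum_(k <- map g s) k%:R `^ (- t) <= _).
  rewrite big_map mulr_sumr [leLHS]big_seq [leRHS]big_seq; apply: ler_sum => n ns.
  have g0 : 0 < (g n)%:R :> R by rewrite ltr0n g1.
  rewrite -powRM ?(ltW de0) ?(ltW g0)// !powRN lef_pV2 ?posrE ?powR_gt0 ?mulr_gt0//.
    apply: ge0_ler_powR; rewrite ?nnegrE ?mulr_ge0 ?(ltW t0) ?(ltW de0)//.
      by apply: le_trans (ds _ ns); exact: ltW.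
    by have /andP[+ _] := gd _ ns; rewrite ler_pdivlMr// mulrC.
  by apply: lt_le_trans (ds _ ns).
rewrite ler_pM2l ?powR_gt0//; apply: le_trans KP _; exact: powR_nat_sum_le.
Qed.

(** Among terms of one sign the absolute values inherit the separation; the factor 2 accounts for
    the two signs. *)
Lemma separated_sum (R : realType) (t delta : R) (s : seq nat) (e : nat -> R) :
  1 < t -> 0 < delta -> uniq s -> {in s, forall n, delta <= `|e n|} ->
  {in s &, forall n m, n != m -> delta <= `|e n - e m|} ->
  \sum_(n <- s) `|e n| `^ (- t) <= 2 * (1 + (t - 1)^-1) * delta `^ (- t).
Proof.
move=> t1 de0 us es sep.
rewrite (bigID (fun n => 0 <= e n))/= -big_filter -[X in _ + X]big_filter -mulrA mulr_natl mulr2n.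
apply: lerD; apply: separated_sum_pos; rewrite ?filter_uniq//.
- by move=> n; rewrite mem_filter => /andP[_]; exact: es.
- move=> n m; rewrite !mem_filter => /andP[en ns] /andP[em ms] nm.
  by rewrite (ger0_norm en) (ger0_norm em); exact: sep.
- by move=> n; rewrite mem_filter => /andP[_]; exact: es.
- move=> n m; rewrite !mem_filter -!ltNge => /andP[en ns] /andP[em ms] nm.
  by rewrite (ltr0_norm en) (ltr0_norm em) opprK addrC distrC; exact: sep.
Qed.

(** With v = (tau - 1) ln q, q psi(q) equals (1 + v) e^(-v). The summand 1 makes this decreasing for
    v >= 0 and keeps psi(q) above q^(-tau). *)
Definition psi_log (R : realType) (tau : R) (q : nat) : R :=
  q%:R `^ (- tau) * (1 + (tau - 1) * ln q%:R).

Lemma expRN_mul1D_le (R : realType) (u v : R) : 0 <= u -> u <= v ->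
  expR (- v) * (1 + v) <= expR (- u) * (1 + u).
Proof.
move=> u0 uv; have -> : expR (- u) = expR (- v) * expR (v - u).
  by rewrite -expRD; congr expR; ring.
rewrite -mulrA ler_pM2l ?expR_gt0//.
by have := expR_ge1Dx (v - u); nra.
Qed.

Lemma mulr_psi_log (R : realType) (tau : R) (q : nat) : (0 < q)%N ->
  q%:R * psi_log tau q =
    expR (- ((tau - 1) * ln q%:R)) * (1 + (tau - 1) * ln q%:R).
Proof.
move=> q0; have q0R : 0 < q%:R :> R by rewrite ltr0n.
rewrite /psi_log mulrA; congr (_ * _).
rewrite -[X in X * _]powRr1 ?(ltW q0R)// -powRD; last by rewrite (gt_eqF q0R) implybT.
by rewrite /powR gt_eqF//; congr expR; ring.
Qed.

Lemma mulr_psi_log_le (R : realType) (tau : R) (p q : nat) : 1 < tau ->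
  (0 < p)%N -> (p <= q)%N -> q%:R * psi_log tau q <= p%:R * psi_log tau p.
Proof.
move=> tau1 p0 pq; rewrite !mulr_psi_log ?(leq_trans p0 pq)//.
have p1 : 1 <= p%:R :> R by rewrite ler1n.
have q1 : 1 <= q%:R :> R by rewrite ler1n (leq_trans p0).
apply: expRN_mul1D_le; first by rewrite mulr_ge0 ?ln_ge0// subr_ge0 ltW.
rewrite ler_pM2l ?subr_gt0// ler_ln ?posrE ?ler_nat//; lra.
Qed.

Lemma psi_log_ge (R : realType) (tau : R) (q : nat) : 1 < tau -> (0 < q)%N ->
  q%:R `^ (- tau) <= psi_log tau q.
Proof.
move=> tau1 q0; rewrite /psi_log -[leLHS]mulr1 ler_wpM2l ?powR_ge0// lerDl.
by rewrite mulr_ge0 ?ln_ge0 ?ler1n// subr_ge0 ltW.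
Qed.

Lemma psi_log_gt0 (R : realType) (tau : R) (q : nat) : 1 < tau -> (0 < q)%N ->
  0 < psi_log tau q.
Proof.
by move=> ? ?; apply: lt_le_trans (psi_log_ge _ _); rewrite ?powR_gt0 ?ltr0n.
Qed.

Lemma psi_log_le (R : realType) (tau : R) (p q : nat) : 1 < tau ->
  (0 < p)%N -> (p <= q)%N -> psi_log tau q <= psi_log tau p.
Proof.
move=> tau1 p0 pq; have q0 := leq_trans p0 pq.
have p0R : 0 < p%:R :> R by rewrite ltr0n.
rewrite -(ler_pM2l p0R); apply: le_trans (mulr_psi_log_le tau1 p0 pq).
by rewrite ler_wpM2r ?ler_nat// ltW// psi_log_gt0.
Qed.

Lemma rden_div_le (p : int) (n : nat) : (0 < n)%N ->
  (rden (p%:~R / n%:R) <= n)%N.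
Proof.
move=> n0; set r : rat := _ / _.
have n0q : n%:R != 0 :> rat by rewrite pnatr_eq0 -lt0n.
have E : numq r * n%:Z = p * denq r.
  have d0 : (denq r)%:~R != 0 :> rat by rewrite intr_eq0 denq_neq0.
  apply: (@intr_inj rat); rewrite !rmorphM/= -[n%:~R]/(n%:R).
  have := divq_num_den r; rewrite {3}/r => /eqP; rewrite eqr_div// => /eqP ->.
  by [].
apply: dvdn_leq => //; have := coprime_num_den r; rewrite coprime_sym => cop.
rewrite -(Gauss_dvdr _ cop); apply/dvdnP; exists `|p|%N.
by rewrite -[n]/(`|n%:Z|%N) -abszM E abszM.
Qed.

(** The reduced denominator of p/n is at most n, so psi at it is at least psi(n); then q psi(q),
    decreasing in q, is taken at the larger N to get one bound for all n. *)
Lemma approximable_psi_log_dist (R : realType) (tau x c : R) : 1 < tau -> 0 < c ->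
  (forall r : rat, c * psi_log tau (rden r) <= `|x - ratr r|) ->
  forall (n N : nat) (p : int), (0 < n <= N)%N ->
    c * (N%:R * psi_log tau N) <= `|n%:R * x - p%:~R|.
Proof.
move=> tau1 c0 xc n N p /andP[n0 nN].
have n0R : 0 < n%:R :> R by rewrite ltr0n.
pose r : rat := p%:~R / n%:R.
have -> : n%:R * x - p%:~R = n%:R * (x - ratr r) :> R.
  rewrite /r fmorph_div/= ratr_int ratr_nat mulrBr; congr (_ - _).
  by rewrite mulrC divfK// gt_eqF.
rewrite normrM (gtr0_norm n0R).
apply: (@le_trans _ _ (c * (n%:R * psi_log tau n))).
  by rewrite ler_pM2l//; exact: mulr_psi_log_le.
rewrite mulrCA ler_pM2l//; apply: le_trans (xc r).
by rewrite ler_pM2l// psi_log_le ?rden_gt0 ?rden_div_le.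
Qed.

(* For n < 2^(i+1) the signed distances from n x to the nearest integer are
   separated by c 2^(i+1) psi(2^(i+1)). *)
Lemma psi_log_dyadic_block (R : realType) (tau t x c : R) (i : nat) :
  1 < t -> 1 < tau -> 0 < c -> irrational x ->
  (forall r : rat, c * psi_log tau (rden r) <= `|x - ratr r|) ->
  \sum_(2 ^ i <= n < 2 ^ i.+1)
      n%:R `^ (- (t * (tau - 1))) * `|sin (pi * n%:R * x)| `^ (- t) <=
    2 * (1 + (t - 1)^-1) * 2 `^ (t * (tau - 1)) *
      (c * ((tau - 1) * ln 2)) `^ (- t) * i.+1%:R `^ (- t).
Proof.
move=> t1 tau1 c0 xirr xc; have t0 : 0 < t by lra.
have tau0 : 0 < tau - 1 by rewrite subr_gt0.
have ln20 : 0 < ln 2 :> R by rewrite ln_gt0// ltr1n.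
pose p n := projT1 (cid (ex_nearest_int (n%:R * x))).
pose e n := n%:R * x - (p n)%:~R.
have e12 n : `|e n| <= 2^-1 by rewrite /e /p; case: cid.
pose Q := (2 ^ i.+1)%N; have Q0 : (0 < Q)%N by rewrite expn_gt0.
have QR0 : 0 < Q%:R :> R by rewrite ltr0n.
pose delta := c * (Q%:R * psi_log tau Q).
have de0 : 0 < delta by rewrite mulr_gt0// mulr_gt0// psi_log_gt0.
have sep n : n \in index_iota (2 ^ i) Q -> (0 < n <= Q)%N.
  rewrite mem_index_iota => /andP[n1 /ltnW ->]; rewrite andbT.
  by apply: leq_trans n1; rewrite expn_gt0.
have dist := approximable_psi_log_dist tau1 c0 xc.
have block := @separated_sum R t delta (index_iota (2 ^ i) Q) e t1 de0 (iota_uniq _ _).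
(* The difference e n - e m is (n - m) x minus an integer, and n - m is still between 1 and Q, so
   the lower bound for single terms applies to it. *)
have sep2 m n : m \in index_iota (2 ^ i) Q -> n \in index_iota (2 ^ i) Q ->
    (m < n)%N -> delta <= `|e n - e m|.
  move=> ms ns mn; have -> : e n - e m = (n - m)%:R * x - (p n - p m)%:~R.
    by rewrite /e natrB ?(ltnW mn)// intrB; ring.
  apply: dist; rewrite subn_gt0 mn/=; apply: leq_trans (leq_subr _ _) _.
  by have /andP[] := sep _ ns.
have {}block : \sum_(2 ^ i <= n < Q) `|e n| `^ (- t) <=
    2 * (1 + (t - 1)^-1) * delta `^ (- t).
  apply: block => [n ns|n m ns ms]; first exact: dist (sep _ ns).
  by rewrite neq_ltn => /orP[nm|mn]; [rewrite distrC|]; exact: sep2.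
apply: (@le_trans _ _ ((2 ^ i)%:R `^ (- (t * (tau - 1))) *
    \sum_(2 ^ i <= n < Q) `|e n| `^ (- t))).
  rewrite mulr_sumr [leLHS]big_seq [leRHS]big_seq; apply: ler_sum => n ns.
  have n0 : (0 < n)%N by have /andP[] := sep _ ns.
  have en0 : 0 < `|e n| by apply: irrational_natmul_neq.
  apply: ler_pM; rewrite ?powR_ge0//.
    rewrite !powRN lef_pV2 ?posrE ?powR_gt0 ?ltr0n ?expn_gt0//.
    apply: ge0_ler_powR; rewrite ?nnegrE ?mulr_ge0 ?(ltW t0) ?(ltW tau0)//.
    by rewrite ler_nat; move: ns; rewrite mem_index_iota => /andP[].
  rewrite !powRN lef_pV2 ?posrE ?powR_gt0 ?normr_sin_pi_gt0//.
  apply: ge0_ler_powR; rewrite ?nnegrE ?(ltW t0)//.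
  by rewrite -mulrA; apply: normr_sin_pi_ge; exact: e12.
apply: le_trans (ler_wpM2l (powR_ge0 _ _) block) _.
(* As ln Q = (i+1) ln 2, the logarithm in the gauge gives delta >= Q^(1-tau) c (tau-1) (i+1) ln 2:
   this is the source of the summable factor (i+1)^(-t). *)
have deltaE : delta `^ (- t) <=
    Q%:R `^ (t * (tau - 1)) * ((c * ((tau - 1) * ln 2)) `^ (- t) * i.+1%:R `^ (- t)).
  rewrite -powRM ?mulr_ge0 ?(ltW c0) ?(ltW tau0) ?(ltW ln20)//.
  have -> : Q%:R `^ (t * (tau - 1)) = (Q%:R `^ (1 - tau)) `^ (- t) :> R.
    by rewrite -powRrM; congr (_ `^ _); ring.
  have kpos : 0 < c * ((tau - 1) * ln 2) * i.+1%:R by rewrite !mulr_gt0.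
  rewrite -powRM ?powR_ge0 ?(ltW kpos)//.
  have k1 : 0 < Q%:R `^ (1 - tau) * (c * ((tau - 1) * ln 2) * i.+1%:R).
    by rewrite mulr_gt0// powR_gt0.
  rewrite !powRN lef_pV2 ?posrE ?(powR_gt0 _ de0) ?(powR_gt0 _ k1)//.
  apply: ge0_ler_powR; rewrite ?nnegrE ?(ltW t0) ?(ltW k1) ?(ltW de0)//.
  rewrite /delta mulr_psi_log//.
  have -> : expR (- ((tau - 1) * ln Q%:R)) = Q%:R `^ (1 - tau) :> R.
    by rewrite /powR gt_eqF//; congr expR; ring.
  have -> : ln Q%:R = i.+1%:R * ln 2 :> R.
    by rewrite /Q natrX -powR_mulrn// ln_powR.
  have -> : Q%:R `^ (1 - tau) * (c * ((tau - 1) * ln 2) * i.+1%:R) =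
      c * (Q%:R `^ (1 - tau) * ((tau - 1) * (i.+1%:R * ln 2))) by ring.
  by rewrite ler_pM2l// ler_pM2l ?powR_gt0// lerDr.
apply: le_trans (ler_wpM2l (powR_ge0 _ _) (ler_wpM2l _ deltaE)) _.
  by rewrite mulr_ge0// addr_ge0// invr_ge0 subr_ge0 ltW.
have -> : (2 ^ i)%:R `^ (- (t * (tau - 1))) =
    2 `^ (t * (tau - 1)) * (Q%:R `^ (t * (tau - 1)))^-1 :> R.
  by rewrite /Q expnS natrM powRM ?ler0n// powRN invfM mulrA divff ?mul1r// gt_eqF// powR_gt0.
set u := 2 `^ _; set v := Q%:R `^ _; rewrite le_eqVlt; apply/orP; left; apply/eqP.
by field; rewrite !gt_eqF ?powR_gt0// subr_gt0.
Qed.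

(** Adding the dyadic blocks bounds the partial sums by a multiple of those of the series of k^(-t),
    which is finite as t > 1. *)
Lemma flint_hills_psi_log_lty (R : realType) (tau t x : R) :
  1 < t -> 1 < tau -> irrational x -> approximable (psi_log tau) x ->
  (flint_hills (t * (tau - 1)) t x < +oo)%E.
Proof.
move=> t1 tau1 xirr [[c c0 xc] _].
pose f n : R := n%:R `^ (- (t * (tau - 1))) * `|sin (pi * n%:R * x)| `^ (- t).
pose A := 2 * (1 + (t - 1)^-1) * 2 `^ (t * (tau - 1)) *
  (c * ((tau - 1) * ln 2)) `^ (- t).
have f0 n : 0 <= f n by rewrite mulr_ge0 ?powR_ge0.
have A0 : 0 <= A.
  by rewrite !mulr_ge0 ?powR_ge0// addr_ge0// invr_ge0 subr_ge0 ltW.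
apply: (@le_lt_trans _ _ (A * (1 + (t - 1)^-1))%:E); last exact: ltry.
apply: nneseries_le_partial => // n.
have dyadic K : \sum_(1 <= k < 2 ^ K) f k <= A * \sum_(1 <= k < K.+1) k%:R `^ (- t).
  elim: K => [|K IH]; first by rewrite !big_geq// mulr0.
  rewrite [leRHS]mulr_sumr big_nat_recr//= -mulr_sumr.
  rewrite (@big_cat_nat _ _ _ (2 ^ K)) ?expn_gt0 ?leq_exp2l//=.
  by apply: lerD => //; exact: psi_log_dyadic_block.
apply: (@le_trans _ _ (\sum_(1 <= k < 2 ^ n) f k)).
  have [n1|n1] := leqP n 1; first by rewrite big_geq// sumr_ge0.
  rewrite [leRHS](@big_cat_nat _ _ _ n)//=; last by rewrite ltnW// ltn_expl.
    by rewrite lerDl sumr_ge0.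
  exact: ltnW.
apply: le_trans (dyadic n) _.
by rewrite ler_wpM2l// powR_nat_sum_le.
Qed.

(** * Upper bound for the dimension *)

(* The index n encodes a fraction with denominator below 2^a: writing
   n = 2^L + P 2^a + q with P 2^a + q < 2^L and a = floor(L / w), it stands for
   (P - 2^(L-a-1)) / q.  As w > 2, the numerators allowed grow faster than the
   denominators, so every rational with large denominator and bounded absolute
   value is met. *)
Section exact_exponent_cover.
Variables (R : realType) (w sigma : R).

Definition cover_exp (n : nat) : nat := Num.truncn ((trunc_log 2 n)%:R / w).

Definition cover_center (n : nat) : R :=
  let L := trunc_log 2 n in let a := cover_exp n in
  let m := (n - 2 ^ L)%N in
  ((m %/ 2 ^ a)%:R - (2 ^ (L - a - 1))%:R) / (m %% 2 ^ a)%:R.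

(** The fractions that need covering are coded with 2^(a-1) <= q < 2^a, so this radius is at least
    q^(-sigma). *)
Definition cover_radius (n : nat) : R := 2 `^ (sigma * (1 - (cover_exp n)%:R)).

(** The exponent a exceeds L/w - 1, and n + 1 <= 2^(L+1); hence the radius decays like
    n^(-sigma/w). *)
Lemma cover_radius_le (n : nat) : 2 < w -> 0 < sigma ->
  cover_radius n <= 2 `^ (2 * sigma) * 2 `^ (sigma / w) * n.+1%:R `^ (- (sigma / w)).
Proof.
move=> w2 s0; have w0 : 0 < w by lra.
rewrite /cover_radius /cover_exp; set L := trunc_log 2 n.
have La : L%:R / w < (Num.truncn (L%:R / w)).+1%:R.
  by have /andP[] := truncn_itv (divr_ge0 (ler0n R L) (ltW w0)).
set a := Num.truncn _ in La *.
apply: (@le_trans _ _ (2 `^ (2 * sigma) * (2 ^ L)%:R `^ (- (sigma / w)))).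
  rewrite natrX -powR_mulrn// -powRrM -powRD; last by rewrite pnatr_eq0 implybT.
  apply: ler_powR; first by rewrite ler1n.
  have -> : 2 * sigma + L%:R * - (sigma / w) = sigma * (2 - L%:R / w) by ring.
  by rewrite ler_pM2l//; rewrite -natr1 in La; lra.
rewrite -mulrA ler_wpM2l ?powR_ge0//.
have n0 : 0 < n.+1%:R :> R by [].
rewrite !powRN ler_pdivlMr ?powR_gt0// mulrC ler_pdivrMr ?powR_gt0 ?ltr0n ?expn_gt0//.
rewrite -powRM// ?ler0n//.
apply: ge0_ler_powR; rewrite ?nnegrE ?divr_ge0 ?(ltW s0) ?(ltW w0)//.
by rewrite -natrM ler_nat -expnS; exact: trunc_log_ltn.
Qed.

Lemma ex_cover_center (x : R) (N : nat) : 2 < w -> 0 < sigma ->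
  exists K, forall r : rat, (K <= rden r)%N ->
    `|x - ratr r| < (rden r)%:R `^ (- sigma) ->
    exists2 n, (N <= n)%N & `|x - cover_center n| < cover_radius n.
Proof.
move=> w2 s0; have w0 : 0 < w by lra.
pose M := Num.truncn (`|x| + 1).
have xM : `|x| + 1 < (2 ^ M.+1)%:R.
  have h0 : 0 <= `|x| + 1 by rewrite addr_ge0.
  have /andP[_ h] := truncn_itv h0.
  by apply: lt_trans h _; rewrite ltr_nat ltn_expl.
(* The second argument makes (w - 2) a at least M + 2, which leaves room for numerators up to
   2^(a+M+1); the first one ensures N <= n. *)
pose i0 := maxn N (Num.truncn (M.+2%:R / (w - 2))).
exists (2 ^ i0)%N => r r0 rx.
have q0 := rden_gt0 r; have q0R := rden_gt0R R r.
set q := rden r in q0 q0R r0 rx *.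
pose i := trunc_log 2 q; pose a := i.+1.
have /andP[iq qa] : (2 ^ i <= q < 2 ^ a)%N by rewrite trunc_logP//= trunc_log_ltn.
have i0i : (i0 <= i)%N by exact: trunc_log_max.
have wa0 : 0 <= w * a%:R by rewrite mulr_ge0 ?(ltW w0).
(* With w a < L <= w a + 1, the integer part of L / w is a, so the index is decoded with the same
   a. *)
pose L := (Num.truncn (w * a%:R)).+1.
have /andP[L1 L2] : (w * a%:R < L%:R) && (L%:R <= w * a%:R + 1).
  by have /andP[h ->] := truncn_itv wa0; rewrite /L -natr1 lerD2r.
have aL : Num.truncn (L%:R / w) = a.
  apply: truncn_def; rewrite ler_pdivlMr// ltr_pdivrMr// -[a.+1%:R]natr1 mulrDl mul1r.
  by move: L1 L2; rewrite ![_ * w]mulrC; move: (w * a%:R) (L%:R : R) => u v; lra.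
have LaM : (a + M.+1 <= L - a - 1)%N.
  suff : (a + a + M.+2 <= L)%N by clear; lia.
  rewrite -(ler_nat R) !natrD; apply: le_trans (ltW L1).
  have : M.+2%:R / (w - 2) <= a%:R.
    have h0 : 0 <= M.+2%:R / (w - 2) by rewrite divr_ge0// subr_ge0 ltW.
    have /andP[_ /ltW h] := truncn_itv h0; apply: le_trans h _.
    by rewrite ler_nat ltnS (leq_trans _ i0i)// leq_maxr.
  by rewrite ler_pdivrMr ?subr_gt0//; lra.
have rx1 : `|ratr r| < (2 ^ M.+1)%:R :> R.
  have : `|x - ratr r| <= 1.
    apply: le_trans (ltW rx) _; rewrite powRN invf_le1 ?powR_gt0//.
    by rewrite -[leLHS](powRr0 q%:R) ler_powR ?ler1n ?ltW.
  by have := ler_distD x (ratr r) 0; rewrite !subr0 distrC; lra.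
have arith (u v e : nat) : (v + e.+1 <= u - v - 1)%N ->
    [/\ u - v = (u - v - 1).+1, u = u - v + v & v <= u]%N by clear; split; lia.
have [LaE LE aL'] := arith _ _ _ LaM.
pose B := (2 ^ (L - a - 1))%N.
have numB : `|(numq r)%:~R| < B%:R :> R.
  rewrite numq_ratr normrM (gtr0_norm q0R).
  apply: (@lt_le_trans _ _ ((2 ^ a)%:R * (2 ^ M.+1)%:R)).
    by apply: ltr_pM; rewrite ?ltr_nat.
  by rewrite -natrM -expnD ler_nat leq_exp2l.
(* The shift by [B] turns numerators of absolute value below B into naturals below 2^(L-a). *)
pose P := `|(numq r + B%:Z)%R|%N.
have PE : P%:R = (numq r)%:~R + B%:R :> R.
  rewrite natr_absz intr_norm intrD -[B%:~R]/(B%:R).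
  by rewrite ger0_norm//; move: numB; rewrite ltr_norml; lra.
have PB : (P < 2 ^ (L - a))%N.
  rewrite LaE -(ltr_nat R) PE expnS natrM -/B.
  by move: numB; rewrite ltr_norml; lra.
have mL : (P * 2 ^ a + q < 2 ^ L)%N.
  apply: (@leq_trans (P.+1 * 2 ^ a)); first by rewrite mulSn [ltnRHS]addnC ltn_add2l.
  rewrite [X in (_ <= 2 ^ X)%N]LE.
  by rewrite expnD leq_mul2r PB orbT.
pose n := (2 ^ L + (P * 2 ^ a + q))%N.
have nL : trunc_log 2 n = L.
  apply: trunc_log_eq => //; rewrite leq_addr/= expnS mul2n -addnn.
  by rewrite ltn_add2l.
exists n.
  apply: (@leq_trans (2 ^ L)); last exact: leq_addr.
  apply: leq_trans (ltnW (ltn_expl L _)) => //.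
  apply: leq_trans aL'; apply: leq_trans (leqnSn i).
  by rewrite (leq_trans _ i0i)// leq_maxl.
have -> : cover_center n = ratr r.
  rewrite /cover_center /cover_exp nL aL /n addKn.
  rewrite divnMDl ?expn_gt0// divn_small// addn0 modnMDl modn_small//.
  by rewrite -/B PE addrK ratr_num_den.
rewrite /cover_radius /cover_exp nL aL.
apply: lt_le_trans rx _.
have -> : 2 `^ (sigma * (1 - a%:R)) = (2 ^ i)%:R `^ (- sigma) :> R.
  rewrite natrX -powR_mulrn// -powRrM; congr (_ `^ _).
  by rewrite /a -natr1; ring.
rewrite !powRN lef_pV2 ?posrE ?powR_gt0 ?ltr0n ?expn_gt0//.
by apply: ge0_ler_powR; rewrite ?nnegrE ?(ltW s0)// ler_nat.
Qed.

End exact_exponent_cover.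

Lemma exact_exponent_set_null (R : realType) (tau s : R) : 0 < tau ->
  2 / tau < s -> hausdorff_measure s (exact_exponent_set tau) = 0%E.
Proof.
move=> tau0 ts; have s0 : 0 < s by apply: lt_trans ts; rewrite divr_gt0.
have st : 2 / s < tau by rewrite ltr_pdivrMr// mulrC -ltr_pdivrMr.
(* Two midpoints are taken: sigma between 2/s and tau, so that s sigma > 2, then w between 2 and s
   sigma. Thus w > 2, as the coding requires, and s sigma / w > 1 makes the s-th powers of the radii
   summable. *)
pose sigma := (2 / s + tau) / 2.
have sg0 : 0 < sigma by rewrite divr_gt0// addr_gt0// divr_gt0.
have sgt : sigma < tau by rewrite /sigma; lra.
have ss : 2 < s * sigma by rewrite mulrC -ltr_pdivrMr// /sigma; lra.
pose w := (2 + s * sigma) / 2.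
have w2 : 2 < w by rewrite /w; lra.
have w0 : 0 < w by lra.
have th1 : 1 < s * (sigma / w) by rewrite mulrA ltr_pdivlMr// /w; lra.
pose D := 2 * (2 `^ (2 * sigma) * 2 `^ (sigma / w)) : R.
have D0 : 0 <= D by rewrite !mulr_ge0 ?powR_ge0.
apply: (@hausdorff_measure_limsup_eq0 _ _ _
  (fun n => [set x | `|x - cover_center w n| < cover_radius w sigma n])
  (fun n => 2 * cover_radius w sigma n)) => //.
- by move=> n; rewrite mulr_ge0// powR_ge0.
- move=> n x y /= xn yn.
  have := ler_distD (cover_center w n) x y; rewrite (distrC (cover_center w n) y); lra.
- apply: (@le_lt_trans _ _ (\sum_(0 <= n <oo)
      (D `^ s)%:E * (n.+1%:R `^ (- (s * (sigma / w))))%:E)%E).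
    apply: lee_nneseries => [n _ _|n _]; first by rewrite lee_fin powR_ge0.
    rewrite -EFinM lee_fin.
    have -> : - (s * (sigma / w)) = - (sigma / w) * s by ring.
    rewrite powRrM -powRM; [|exact: D0|exact: powR_ge0].
    apply: ge0_ler_powR; rewrite ?nnegrE ?mulr_ge0 ?powR_ge0 ?(ltW s0)//.
    by rewrite /D -(mulrA 2) ler_pM2l//; exact: cover_radius_le w2 sg0.
  rewrite nneseriesZl; last by move=> n _; rewrite lee_fin powR_ge0.
  by apply: lte_mul_pinfty; rewrite ?lee_fin ?powR_ge0// powR_nneseries_lty.
- move=> x xe N; have [K KP] := @ex_cover_center _ w sigma x N w2 sg0.
  have [r rK rx] := exact_infinitely_often sg0 sgt xe K.
  exact: KP rK rx.
Qed.

(** * The Cantor set *)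

(** The integer parts of (f a - A) / delta are distinct and at most Lam / delta. *)
Lemma packing (R : realType) (T : eqType) (l : seq T) (f : T -> R) (A Lam delta : R) :
  uniq l -> 0 < delta -> 0 <= Lam -> {in l, forall a, A <= f a <= A + Lam} ->
  {in l &, forall a b, a != b -> delta <= `|f a - f b|} ->
  (size l)%:R <= 1 + Lam / delta.
Proof.
move=> ul de0 La0 fA sep.
pose g a := Num.truncn ((f a - A) / delta).
have ga a : a \in l -> (g a)%:R <= (f a - A) / delta < (g a).+1%:R.
  move=> al; apply: truncn_itv; rewrite divr_ge0 ?(ltW de0)// subr_ge0.
  by have /andP[] := fA _ al.
have ginj : {in l &, injective g}.
  move=> a b al bl gab; apply/eqP; apply/negPn/negP => ab.
  have := sep _ _ al bl ab; rewrite leNgt => /negP; apply.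
  have := ga _ al; have := ga _ bl; rewrite gab -natr1 => /andP[a1 a2] /andP[b1 b2].
  rewrite -[ltRHS]mul1r -ltr_pdivrMr// -[X in _ / X](gtr0_norm de0) -normf_div.
  have -> : (f a - f b) / delta = (f a - A) / delta - (f b - A) / delta by ring.
  by rewrite ltr_norml; lra.
have um : uniq (map g l) by rewrite map_inj_in_uniq.
pose K := Num.truncn (Lam / delta).
have Ld : 0 <= Lam / delta by rewrite divr_ge0// ltW.
have /andP[KL _] := truncn_itv Ld.
have : (size (map g l) <= size (iota 0 K.+1))%N.
  apply: uniq_leq_size => // _ /mapP[a al ->]; rewrite mem_iota/= add0n ltnS.
  apply: le_truncn; rewrite ler_pM2r ?invr_gt0//.
  by have /andP[_] := fA _ al; rewrite lerBlDl.
rewrite size_map size_iota => h.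
apply: (@le_trans _ _ K.+1%:R); first by rewrite ler_nat.
by rewrite -natr1; lra.
Qed.

Lemma size_fiber_le (R : realType) (T U : eqType) (l : seq T) (s : seq U)
    (h : T -> U) (M : R) : 0 <= M -> {in l, forall j, h j \in s} ->
  {in s, forall r, (count (fun j => h j == r) l)%:R <= M} ->
  (size l)%:R <= (size s)%:R * M.
Proof.
move=> M0; elim: s l => [|r s IH] l hs hM.
  case: l hs {hM} => [|j l] hs; first by rewrite mul0r.
  by have := hs j (mem_head _ _).
rewrite -(count_predC (fun j => h j == r)) natrD [(size _)%:R]/= -natr1 mulrDl mul1r addrC.
apply: lerD; last by apply: hM; rewrite mem_head.
rewrite -size_filter; apply: IH => [j|r' r's].
  by rewrite mem_filter/= => /andP[hj /hs]; rewrite inE (negPf hj).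
apply: le_trans (hM r' _); last by rewrite inE r's orbT.
rewrite ler_nat count_filter; apply: sub_count => j /=.
by case/andP.
Qed.

Lemma count_has_le (T U : Type) (P : U -> pred T) (s : seq U) (l : seq T) :
  (count (fun j => has (P^~ j) s) l <= \sum_(i <- s) count (P i) l)%N.
Proof.
elim: s => [|i s IH]; first by rewrite big_nil /= count_pred0.
rewrite big_cons /=; apply: leq_trans (leq_add (leqnn _) IH).
by rewrite -count_predUI leq_addr.
Qed.

Lemma geometric_sum_le (R : realType) (a : R) (i n : nat) : 0 <= a < 1 ->
  \sum_(i <= k < n) a ^+ k <= a ^+ i / (1 - a).
Proof.
move=> /andP[a0 a1]; have a10 : 0 < 1 - a by rewrite subr_gt0.
have [ni|ni] := leqP n i.
  by rewrite big_geq// divr_ge0 ?exprn_ge0// ltW.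
rewrite -(subnKC (ltnW ni)) ler_pdivlMr//.
suff -> : (\sum_(i <= k < i + (n - i)) a ^+ k) * (1 - a) = a ^+ i - a ^+ (i + (n - i)).
  by rewrite gerBl exprn_ge0.
elim: (n - i)%N => [|m IH]; first by rewrite addn0 big_geq// mul0r subrr.
rewrite addnS big_nat_recr ?leq_addr//= mulrDl IH exprS; ring.
Qed.

(* Dirichlet's theorem, up to a factor 2 that spares the case of a
   non-integral W. *)
Lemma dirichlet (R : realType) (y W : R) : 1 <= W ->
  exists2 r : rat, (rden r)%:R <= W & `|y - ratr r| < 2 / ((rden r)%:R * W).
Proof.
move=> W1; have W0 : 0 < W by lra.
pose N := Num.truncn W; have /andP[NW WN] := truncn_itv (ltW W0).
rewrite -natr1 in WN; have N1 : 1 <= N%:R :> R by rewrite ler1n truncn_gt0.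
pose f (k : nat) : R := k%:R * y - (Num.floor (k%:R * y))%:~R.
have f01 k : 0 <= f k <= 0 + 1.
  have := floor_itv (k%:R * y); rewrite intrD (_ : 1%:~R = 1 :> R)// => /andP[].
  by rewrite /f; lra.
have [a [b [ab bN fab]]] : exists a b, [/\ (a < b)%N, (b <= N)%N & `|f a - f b| < 2 / W].
  apply: contrapT => nex.
  have sep a b : (a < b)%N -> (b <= N)%N -> 2 / W <= `|f a - f b|.
    by move=> ab bN; rewrite leNgt; apply/negP => h; apply: nex; exists a, b.
  have := @packing R _ (iota 0 N.+1) f 0 1 (2 / W) (iota_uniq _ _) (divr_gt0 _ W0) ler01.
  rewrite size_iota => /(_ (ltr0n _ 2)) /(_ (fun k _ => f01 k)) h.
  suff : N.+1%:R <= 1 + 1 / (2 / W) :> R.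
    by rewrite div1r invf_div -natr1; lra.
  apply: h => a b; rewrite !mem_iota/= !add0n !ltnS => aN bN.
  by rewrite neq_ltn => /orP[ab|ba]; [|rewrite distrC]; exact: sep.
pose q := (b - a)%N; have q0 : (0 < q)%N by rewrite subn_gt0.
have q0R : 0 < q%:R :> R by rewrite ltr0n.
pose p := Num.floor (b%:R * y) - Num.floor (a%:R * y).
pose r : rat := p%:~R / q%:R.
have rq : (rden r)%:R <= q%:R :> R by rewrite ler_nat rden_div_le.
have qN : q%:R <= N%:R :> R by rewrite ler_nat (leq_trans (leq_subr _ _)).
exists r; first lra.
have rd0 := rden_gt0R R r.
have qy : q%:R * `|y - ratr r| = `|f a - f b|.
  rewrite -[X in X * _]gtr0_norm// -normrM mulrBr /r fmorph_div/= ratr_int ratr_nat.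
  rewrite [X in _ - X]mulrC divfK ?gt_eqF// distrC /q natrB ?(ltnW ab)// /p intrB /f.
  by congr `|_|; ring.
rewrite ltr_pdivlMr ?mulr_gt0// mulrA -ltr_pdivlMr//.
apply: le_lt_trans fab; rewrite -qy mulrC ler_wpM2r//.
Qed.

(** Fractions with denominators below 2^(i+1) are 4^(-i-1) apart, so O(4^i l) of them are near an
    interval of length l, and each one is within 3 z^i of O(z^i / z^n) grid points. *)
Lemma count_near_rationals (R : realType) (z u l : R) (i n m : nat) :
  0 < z -> 4 * z < 1 -> (i <= n)%N -> 1 <= 4 ^+ i * l ->
  2 * m%:R * (8 * z ^+ n) <= l ->
  (count (fun j : nat => `[< exists r : rat, (2 ^ i <= rden r < 2 ^ i.+1)%N /\
      `|u + j.+1%:R * (8 * z ^+ n) - ratr r| < 3 * z ^+ i >]) (iota 0 (2 * m)))%:R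
    <= 58 * l * (4 * z) ^+ i / z ^+ n.
Proof.
move=> z0 z1 iN il ml.
have zi : 0 < z ^+ i by rewrite exprn_gt0.
have zn : 0 < z ^+ n by rewrite exprn_gt0.
have zni : z ^+ n <= z ^+ i.
  by rewrite -(subnKC iN) exprD ler_piMr ?(ltW zi)// exprn_ile1 ?(ltW z0)//; lra.
set y := fun j : nat => u + j.+1%:R * (8 * z ^+ n).
set P := fun j : nat => `[< _ >].
have l0 : 0 < l.
  by rewrite -(@pmulr_rgt0 _ (4 ^+ i)) ?exprn_gt0//; lra.
rewrite -size_filter; set L := seq.filter P _.
have uL : uniq L by rewrite filter_uniq// iota_uniq.
have LP j : j \in L -> (j < 2 * m)%N /\ P j.
  by rewrite mem_filter mem_iota/= add0n => /andP[].
pose h j : rat := if pselect (exists r : rat, (2 ^ i <= rden r < 2 ^ i.+1)%N /\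
      `|y j - ratr r| < 3 * z ^+ i) is left e then projT1 (cid e) else 0.
have hP j : j \in L -> (rden (h j) < 2 ^ i.+1)%N /\ `|y j - ratr (h j)| < 3 * z ^+ i.
  move=> /LP[_ /asboolP Pj]; rewrite /h; case: pselect => // e.
  by case: cid => r /= [/andP[]].
pose s := undup (map h L).
have yl j : j \in L -> u <= y j <= u + l.
  move=> /LP[jm _]; rewrite /y lerDl mulr_ge0 ?mulr_ge0 ?(ltW zn)//= lerD2l.
  apply: le_trans ml; rewrite ler_pM2r ?mulr_gt0//.
  by rewrite -natrM ler_nat.
have zil : z ^+ i * 4 ^+ i <= 1.
  by rewrite -exprMn mulrC exprn_ile1//; lra.
(* Packing gives 1 + 4 X + 24 (4 z)^i with X = 4^i l >= 1, and 1 + 4 + 24 = 29. *)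
have ss : (size s)%:R <= 29 * (4 ^+ i * l).
  have sl : {in s, forall r : rat, u - 3 * z ^+ i <= ratr r <= u - 3 * z ^+ i + (l + 6 * z ^+ i)}.
    move=> r; rewrite mem_undup => /mapP[j jL ->].
    by have := yl _ jL; have [_] := hP _ jL; rewrite ltr_norml; lra.
  have d0 : 0 < (4 ^+ i.+1)^-1 :> R by rewrite invr_gt0 exprn_gt0.
  have Lam0 : 0 <= l + 6 * z ^+ i by lra.
  apply: le_trans (packing (undup_uniq _) d0 Lam0 sl _) _; last first.
    by rewrite invrK exprS; nra.
  move=> r r'; rewrite !mem_undup => /mapP[j jL ->] /mapP[k kL ->] /(rden_dist R).
  apply: le_trans; have [r1 _] := hP _ jL; have [r2 _] := hP _ kL.
  rewrite lef_pV2 ?posrE ?mulr_gt0 ?rden_gt0R ?exprn_gt0//.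
  rewrite -natrM -natrX ler_nat (_ : 4 = 2 * 2)%N// expnMn.
  by rewrite leq_mul// ltnW.
have fib : {in s, forall r, (count (fun j => h j == r) L)%:R <= 2 * (z ^+ i / z ^+ n)}.
  move=> r rs; rewrite -size_filter.
  have g0 : 0 < 8 * z ^+ n by rewrite mulr_gt0.
  have Lam0 : 0 <= 6 * z ^+ i by lra.
  apply: le_trans (@packing _ _ _ y (ratr r - 3 * z ^+ i) _ _ _ g0 Lam0 _ _) _.
  - by rewrite filter_uniq.
  - move=> j; rewrite mem_filter => /andP[/eqP <- jL].
    by have [_] := hP _ jL; rewrite ltr_norml; lra.
  - move=> j k _ _ jk; rewrite /y.
    have -> : u + j.+1%:R * (8 * z ^+ n) - (u + k.+1%:R * (8 * z ^+ n)) =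
      (j%:~R - k%:~R) * (8 * z ^+ n) :> R.
      by rewrite -!natr1 -![_%:~R]/(_%:R); ring.
    rewrite normrM (gtr0_norm g0) ler_peMl ?(ltW g0)//.
    rewrite -intrB -intr_norm ler1z -gtz0_ge1 normr_gt0 subr_eq0 eqz_nat.
    exact: jk.
  have : 1 <= z ^+ i / z ^+ n by rewrite ler_pdivlMr// mul1r.
  have -> : 6 * z ^+ i / (8 * z ^+ n) = 3 / 4 * (z ^+ i / z ^+ n) by field; rewrite gt_eqF.
  by lra.
have M0 : 0 <= 2 * (z ^+ i / z ^+ n) by rewrite mulr_ge0 ?divr_ge0 ?ltW.
apply: le_trans (@size_fiber_le R _ _ L s h _ M0 _ fib) _.
  by move=> j jL; rewrite mem_undup map_f.
apply: le_trans (ler_wpM2r M0 ss) _.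
by rewrite exprMn le_eqVlt; apply/orP; left; apply/eqP; ring.
Qed.

Lemma ler_powRN (R : realType) (e a b : R) : 0 <= e -> 0 < a -> a <= b ->
  b `^ (- e) <= a `^ (- e).
Proof.
move=> e0 a0 ab; have b0 : 0 < b by apply: lt_le_trans ab.
rewrite !powRN lef_pV2 ?posrE ?powR_gt0//.
by apply: ge0_ler_powR; rewrite ?nnegrE ?(ltW a0) ?(ltW b0).
Qed.

Lemma natr_pow2 (R : realType) (n : nat) : (2 ^ n)%:R = 2 `^ n%:R :> R.
Proof. by rewrite natrX powR_mulrn. Qed.

Lemma powR2D (R : realType) (a b : R) : 2 `^ (a + b) = 2 `^ a * 2 `^ b.
Proof. by rewrite powRD// pnatr_eq0 implybT. Qed.

Lemma ler_powR2 (R : realType) (a b : R) : a <= b -> 2 `^ a <= 2 `^ b.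
Proof. by apply: ler_powR; rewrite ler1n. Qed.

Lemma powR2_exprn (R : realType) (e : R) (n : nat) :
  (2 `^ e) ^+ n = 2 `^ (e * n%:R).
Proof. by rewrite -powR_mulrn ?powR_ge0// powRrM. Qed.

Lemma powR_expr2_le (R : realType) (e : R) (n q : nat) : 0 <= e ->
  (2 ^ n <= q)%N -> q%:R `^ (- e) <= 2 `^ (- (n%:R * e)).
Proof.
move=> e0 nq; apply: le_trans (@ler_powRN _ e (2 ^ n)%:R q%:R e0 _ _) _.
- by rewrite ltr0n expn_gt0.
- by rewrite ler_nat.
- by rewrite natr_pow2 -powRrM mulrN.
Qed.

Lemma increasing_gap (G : nat -> nat) (m : nat) :
  (forall j k, (j < k)%N -> (k < m)%N -> (G j < G k)%N) ->
  forall j k, (j < k)%N -> (k < m)%N -> (k - j <= G k - G j)%N.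
Proof.
move=> Ginc j; elim=> // k IH; rewrite ltnS leq_eqVlt => /orP[/eqP->|jk] km.
  have := Ginc k k.+1 (ltnSn _) km; lia.
have := IH jk (ltnW km); have := Ginc k k.+1 (ltnSn _) km.
have := Ginc j k jk (ltnW km); lia.
Qed.

(** The counts of bad points form a geometric series of ratio 4 z < 1; the smallness of (4 z)^i0
    leaves at most m bad points among 2 m. *)
Lemma good_grid_points (R : realType) (z u l : R) (i0 n : nat) :
  0 < z -> 4 * z < 1 -> (i0 <= n)%N -> 1 <= 4 ^+ i0 * l ->
  (4 * z) ^+ i0 <= (1 - 4 * z) / 3000 -> 24 * z ^+ n <= l ->
  let m := Num.truncn (l / (24 * z ^+ n)) in
  exists G : nat -> nat,
    [/\ forall j, (j < m)%N -> (G j < 2 * m)%N,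
        forall j k, (j < k)%N -> (k < m)%N -> (k - j <= G k - G j)%N /\ (G j < G k)%N &
        forall j, (j < m)%N -> forall i (r : rat), (i0 <= i < n)%N ->
          (2 ^ i <= rden r < 2 ^ i.+1)%N ->
          3 * z ^+ i <= `|u + (G j).+1%:R * (8 * z ^+ n) - ratr r|].
Proof.
move=> z0 z1 i0n il zi0 znl m.
have zn : 0 < z ^+ n by rewrite exprn_gt0.
have l0 : 0 < l by apply: lt_le_trans znl; rewrite mulr_gt0.
have lz1 : 1 <= l / (24 * z ^+ n) by rewrite ler_pdivlMr ?mulr_gt0// mul1r.
have /andP[m1 m2] := truncn_itv (le_trans ler01 lz1).
rewrite -/m in m1 m2.
have m0 : (1 <= m)%N by rewrite /m truncn_gt0.
pose P i j := `[< exists r : rat, (2 ^ i <= rden r < 2 ^ i.+1)%N /\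
      `|u + j.+1%:R * (8 * z ^+ n) - ratr r| < 3 * z ^+ i >].
pose bad := fun j : nat => has (P^~ j) (index_iota i0 n).
have badm : (count bad (iota 0 (2 * m)) <= m)%N.
  rewrite -(ler_nat R).
  apply: (@le_trans _ _ (\sum_(i0 <= i < n) (count (P i) (iota 0 (2 * m)))%:R)).
    by rewrite -natr_sum ler_nat; exact: count_has_le.
  apply: (@le_trans _ _ (\sum_(i0 <= i < n) (58 * l / z ^+ n) * (4 * z) ^+ i)).
    rewrite [leLHS]big_seq [leRHS]big_seq; apply: ler_sum => i.
    rewrite mem_index_iota => /andP[i0i iN].
    rewrite mulrAC; apply: count_near_rationals => //; first exact: ltnW.
      apply: le_trans il _; rewrite ler_pM2r//.
      by apply: ler_weXn2l => //; rewrite ler1n.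
    move: m1; rewrite ler_pdivlMr ?mulr_gt0//; nra.
  rewrite -mulr_sumr.
  apply: le_trans (ler_wpM2l _ (geometric_sum_le i0 n _)) _.
  - by rewrite divr_ge0 ?mulr_ge0 ?ltW.
  - by rewrite z1 andbT mulr_ge0 ?ltW.
  (* Since l / z^n < 24 (m + 1) <= 48 m, the bad points number at most 58 * 48 m / 3000 < m. *)
  have h : (4 * z) ^+ i0 / (1 - 4 * z) <= 3000^-1.
    by rewrite ler_pdivrMr ?subr_gt0// [leRHS]mulrC.
  apply: le_trans (ler_wpM2l _ h) _; first by rewrite divr_ge0 ?mulr_ge0 ?ltW.
  have lzn : l / z ^+ n = 24 * (l / (24 * z ^+ n)).
    by field; rewrite gt_eqF.
  rewrite -(mulrA 58) lzn; move: m2; rewrite -natr1.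
  by have : 1 <= m%:R :> R by [rewrite ler1n]; lra.
pose L := seq.filter (predC bad) (iota 0 (2 * m)).
have mL : (m <= size L)%N.
  rewrite size_filter -(leq_add2l (count bad (iota 0 (2 * m)))) count_predC.
  by rewrite size_iota [leqRHS]mul2n -[leqRHS]addnn leq_add2r.
have Ls : sorted ltn L by rewrite sorted_filter ?iota_ltn_sorted//; exact: ltn_trans.
have LP j : (j < m)%N -> nth 0%N L j \in L by move=> jm; rewrite mem_nth// (leq_trans jm).
have Linc j k : (j < k)%N -> (k < m)%N -> (nth 0 L j < nth 0 L k)%N.
  move=> jk km; apply: (sorted_ltn_nth ltn_trans) => //; rewrite inE.
    by rewrite (leq_trans (ltn_trans jk km)).
  by rewrite (leq_trans km).
exists (nth 0%N L); split.
- by move=> j /LP; rewrite mem_filter mem_iota => /andP[_]; rewrite add0n.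
- by move=> j k jk km; split; [exact: (increasing_gap Linc)|exact: Linc].
- move=> j /LP; rewrite mem_filter => /andP[/hasPn nb _] i r ii ri.
  rewrite leNgt; apply/negP => lt3; have := nb i; rewrite mem_index_iota => /(_ ii).
  by move/negP; apply; apply/asboolP; exists r.
Qed.

(* The child of a good grid point y: the interval [r + psi(Q), r + psi(Q) + W^-tau]
   to the right of the Dirichlet approximation r = P/Q of y at scale W = 2^(bn). *)
Lemma approximating_interval (R : realType) (psi : nat -> R) (tau tau1 b y : R)
    (I0 i0 i1 n : nat) :
  0 < tau -> 1 < b -> 1 + b <= tau1 ->
  (forall q, (0 < q)%N -> q%:R `^ (- tau) <= psi q) ->
  (forall q, (2 ^ I0 <= q)%N -> psi q <= q%:R `^ (- tau1)) ->
  (I0 <= i0 <= n)%N ->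
  20 * 2 `^ (- (n%:R * tau1)) <= (2 `^ (- (1 + b))) ^+ n ->
  4 * (2 ^ i1)%:R * 2 `^ (n%:R * (1 - tau1)) <= 1 ->
  (forall i (r : rat), (i0 <= i < n)%N -> (2 ^ i <= rden r < 2 ^ i.+1)%N ->
     3 * (2 `^ (- (1 + b))) ^+ i <= `|y - ratr r|) ->
  (forall r : rat, (rden r < 2 ^ i0)%N -> 2 / 2 `^ (b * n%:R) <= `|y - ratr r|) ->
  exists v : R, [/\ `|v - y| <= (2 + 20^-1) * (2 `^ (- (1 + b))) ^+ n,
    exists2 r : rat, (2 ^ n <= rden r)%N &
      forall x, v <= x <= v + 2 `^ (- (b * n%:R * tau)) -> `|x - ratr r| <= 2 * psi (rden r) &
    forall x, v <= x <= v + 2 `^ (- (b * n%:R * tau)) ->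
      forall r : rat, (2 ^ i0 <= rden r < 2 ^ i1)%N ->
        psi (rden r) / 4 <= `|x - ratr r|].
Proof.
move=> tau0 b1 btau psi_ge psi_le /andP[I0i0 i0n] N1 N2 far_mid far_small.
set z := 2 `^ (- (1 + b)) in N1 far_mid *.
have z0 : 0 < z by rewrite powR_gt0.
have z1 : z <= 1 by rewrite -(powRr0 2); apply: ler_powR2; lra.
have zE i : z ^+ i = 2 `^ (- (1 + b) * i%:R) by rewrite powR2_exprn.
have zn0 : 0 < z ^+ n by rewrite exprn_gt0.
pose W := 2 `^ (b * n%:R) : R.
have W0 : 0 < W by rewrite powR_gt0.
have W1 : 1 <= W by rewrite -[leLHS](powRr0 2); apply: ler_powR2; rewrite mulr_ge0//; lra.
have [r rW ry] := dirichlet y W1.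
set Q := rden r in rW ry *; have Q0 : (0 < Q)%N by exact: rden_gt0.
have QR0 : 0 < Q%:R :> R by rewrite ltr0n.
have zW i k : (i <= k)%N ->
  (2 ^ i)%:R^-1 * (2 `^ (b * k%:R))^-1 <= z ^+ i.
  move=> ik; rewrite natr_pow2 -!powRN -powR2D zE; apply: ler_powR2.
  have : i%:R <= k%:R :> R by rewrite ler_nat.
  by nra.
(* The value of [z] comes from here: 1 / (2^i W) <= z^i for i <= n, with equality at i = n. *)
have small i : (i <= n)%N -> (2 ^ i <= Q)%N -> `|y - ratr r| < 2 * z ^+ i.
  move=> iN iQ; apply: lt_le_trans ry _; rewrite ler_pM2l// invfM.
  apply: le_trans (zW i n iN).
  rewrite ler_pM2r ?invr_gt0// lef_pV2 ?posrE ?ltr0n ?expn_gt0//.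
  by rewrite ler_nat.
(* A smaller Q would lie either below 2^i0 or in a dyadic block [2^i, 2^(i+1)) with i < n, and y
   keeps away from both kinds of fractions by more than Dirichlet's bound allows. *)
have nQ : (2 ^ n <= Q)%N.
  rewrite leqNgt; apply/negP => Qn.
  have [Qi0|Qi0] := ltnP Q (2 ^ i0).
    have := far_small r Qi0; rewrite leNgt => /negP; apply.
    apply: lt_le_trans ry _; rewrite ler_pM2l// lef_pV2 ?posrE ?mulr_gt0//.
    by rewrite ler_peMl ?(ltW W0)// ler1n.
  pose i := trunc_log 2 Q.
  have /andP[iQ Qi] : (2 ^ i <= Q < 2 ^ i.+1)%N by rewrite trunc_logP//= trunc_log_ltn.
  have i0i : (i0 <= i)%N by exact: trunc_log_max.
  have iN : (i < n)%N by rewrite -(@ltn_exp2l 2)// (leq_ltn_trans iQ).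
  have h1 := small i (ltnW iN) iQ.
  have := far_mid i r; rewrite i0i iN -/Q iQ Qi => /(_ isT isT).
  have : 0 < z ^+ i by rewrite exprn_gt0.
  by lra.
have yr := small n (leqnn n) nQ.
have I0Q : (2 ^ I0 <= Q)%N.
  by apply: leq_trans nQ; rewrite leq_exp2l// (leq_trans I0i0).
have tau10 : 0 <= tau1 by lra.
have psiQ : psi Q <= z ^+ n / 20.
  apply: le_trans (psi_le _ I0Q) _; apply: le_trans (powR_expr2_le tau10 nQ) _.
  by rewrite ler_pdivlMr// mulrC.
have psiQ0 : 0 < psi Q by apply: lt_le_trans (psi_ge _ Q0); rewrite powR_gt0.
set l' := 2 `^ (- (b * n%:R * tau)).
(* Since Q <= W, W^(-tau) <= Q^(-tau) <= psi(Q); the interval therefore stays at distance between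
   psi(Q) and 2 psi(Q) from r. *)
have l'psi : l' <= psi Q.
  apply: le_trans (psi_ge _ Q0); rewrite /l' -mulrN powRrM -/W.
  by apply: ler_powRN => //; exact: ltW.
have l'0 : 0 < l' by rewrite powR_gt0.
have xr x : ratr r + psi Q <= x <= ratr r + psi Q + l' ->
    psi Q <= `|x - ratr r| <= 2 * psi Q.
  by move=> h; rewrite ger0_norm; lra.
exists (ratr r + psi Q); split.
- by move: yr; rewrite ltr_norml ler_norml; lra.
- by exists r => // x /xr /andP[].
move=> x xv r'; set q := rden r' => /andP[qi0 qi1].
have q0 : 0 < q%:R :> R by exact: rden_gt0R.
have qI0 : (2 ^ I0 <= q)%N by apply: leq_trans qi0; rewrite leq_exp2l.
(* For q < 2^n the grid point y is 3 z^i from r' and x is within 2.1 z^n of y, so at least 0.9 z^i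
   remains. *)
have [qn|nq] := ltnP q (2 ^ n).
  pose i := trunc_log 2 q.
  have /andP[iq qi] : (2 ^ i <= q < 2 ^ i.+1)%N.
    by rewrite trunc_logP ?rden_gt0//= trunc_log_ltn.
  have i0i : (i0 <= i)%N by exact: trunc_log_max.
  have iN : (i < n)%N by rewrite -(@ltn_exp2l 2)// (leq_ltn_trans iq).
  have psiq : psi q <= z ^+ i.
    apply: le_trans (psi_le _ qI0) _; apply: le_trans (powR_expr2_le tau10 iq) _.
    by rewrite zE; apply: ler_powR2; have := ler0n R i; nra.
  have := far_mid i r'; rewrite i0i iN -/q iq qi => /(_ isT isT).
  have zni : z ^+ n <= z ^+ i.
    by rewrite -(subnKC (ltnW iN)) exprD ler_piMr ?exprn_ile1 ?exprn_ge0 ?(ltW z0).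
  have zi0 : 0 < z ^+ i by rewrite exprn_gt0.
  have := ler_distD x y (ratr r').
  move: yr; rewrite ltr_norml => /andP[y1 y2].
  have : `|y - x| <= (2 + 10^-1) * z ^+ n by rewrite ler_norml; lra.
  by lra.
have [E|rr'] := eqVneq r' r.
  by have /andP[] := xr _ xv; rewrite /q E -/Q; lra.
(* For r' other than r, the gap 1/(qQ) suffices: 2 psi(Q) takes at most half of it because q < 2^i1,
   and psi(q)/4 fits in the other half because Q <= W <= q^b and 1 + b <= tau1. *)
have := rden_dist R rr'; rewrite -/q -/Q => dist.
have qQ : 0 < q%:R * Q%:R :> R by rewrite mulr_gt0.
have psi2 : 2 * psi Q <= (q%:R * Q%:R)^-1 / 2.
  rewrite -invfM -[leRHS]mul1r ler_pdivlMr ?mulr_gt0//.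
  apply: le_trans N2.
  have h1 : Q%:R * psi Q <= 2 `^ (n%:R * (1 - tau1)).
    apply: (@le_trans _ _ (Q%:R `^ (- (tau1 - 1)))).
      rewrite opprB powRD; last by rewrite (gt_eqF QR0) implybT.
      by rewrite powRr1 ?(ltW QR0)// ler_pM2l//; exact: psi_le.
    by rewrite -[1 - tau1]opprB mulrN; apply: powR_expr2_le nQ; lra.
  have h2 : q%:R <= (2 ^ i1)%:R :> R by rewrite ler_nat ltnW.
  have -> : 2 * psi Q * (q%:R * Q%:R * 2) = 4 * q%:R * (Q%:R * psi Q) by ring.
  by apply: ler_pM; rewrite ?mulr_ge0 ?(ltW psiQ0)// ler_pM2l.
have psiq : psi q / 4 <= (q%:R * Q%:R)^-1 / 2.
  suff : psi q <= (q%:R * Q%:R)^-1.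
    by have : 0 < (q%:R * Q%:R)^-1 :> R by [rewrite invr_gt0]; lra.
  apply: le_trans (psi_le _ qI0) _; rewrite powRN lef_pV2 ?posrE ?powR_gt0//.
  apply: (@le_trans _ _ (q%:R `^ (1 + b))).
    rewrite powRD; last by rewrite (gt_eqF q0) implybT.
    rewrite powRr1 ?(ltW q0)// ler_pM2l//; apply: le_trans rW _.
    rewrite /W [b * _]mulrC powRrM -natr_pow2.
    by apply: ge0_ler_powR; rewrite ?nnegrE ?ler_nat//; lra.
  by apply: ler_powR; rewrite // ler1n rden_gt0.
have /andP[_] := xr _ xv; have := ler_distD x (ratr r') (ratr r).
by rewrite (distrC (ratr r') x); lra.
Qed.

Lemma powR2_large (R : realType) (e A : R) : 0 < e ->
  exists N, forall n, (N <= n)%N -> A <= 2 `^ (e * n%:R).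
Proof.
move=> e0; have ln20 : 0 < ln 2 :> R by rewrite ln_gt0// ltr1n.
have eln : 0 < e * ln 2 by rewrite mulr_gt0.
exists (Num.truncn (`|A| / (e * ln 2))).+1 => n nN.
have h0 : 0 <= `|A| / (e * ln 2) by rewrite divr_ge0// ltW.
have /andP[_ h] := truncn_itv h0.
have : `|A| / (e * ln 2) < n%:R by apply: lt_le_trans h _; rewrite ler_nat.
rewrite ltr_pdivrMr// => h1.
rewrite /powR gt_eqF//; have := expR_ge1Dx (e * n%:R * ln 2).
have := ler_norm A; nra.
Qed.

(** The lower bound in [approximable], demanded only of denominators below 2^i but uniformly on an
    interval; this is the invariant of the Cantor construction. *)
Definition avoids (R : realType) (psi : nat -> R) (c u l : R) (i : nat) : Prop :=
  forall (x : R) (r : rat), u <= x <= u + l -> (rden r < 2 ^ i)%N ->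
    c * psi (rden r) <= `|x - ratr r|.

(* n, hence m, l' and i1, is chosen before u: all the intervals of one level of
   the Cantor set are subdivided in the same way. *)
Lemma cantor_stage (R : realType) (psi : nat -> R) (tau tau1 b d c : R) (I0 : nat) :
  2 < tau -> 1 < b -> tau1 < tau -> b * (tau / 2 + 1) < tau1 ->
  0 < d -> b * tau * d < 1 + b -> 0 < c -> c <= 4^-1 ->
  (forall q, (0 < q)%N -> q%:R `^ (- tau) <= psi q) ->
  (forall p q, (0 < p)%N -> (p <= q)%N -> psi q <= psi p) ->
  (forall q, (2 ^ I0 <= q)%N -> psi q <= q%:R `^ (- tau1)) ->
  let z := 2 `^ (- (1 + b)) in
  forall (l : R) (i0 N0 : nat), 0 < l -> (I0 <= i0)%N -> 1 <= 4 ^+ i0 * l ->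
  (4 * z) ^+ i0 <= (1 - 4 * z) / 3000 ->
  exists (m : nat) (l' : R) (i1 : nat),
    [/\ [/\ (2 <= m)%N, 0 < l' & (i0 < i1)%N], 1 <= 4 ^+ i1 * l', 1 <= m%:R * l' `^ d,
      (4 * z) ^+ i1 <= (1 - 4 * z) / 3000 &
    forall u, avoids psi c u l i0 -> exists v : nat -> R,
      (forall j, (j < m)%N ->
        [/\ u <= v j, v j + l' <= u + l, avoids psi c (v j) l' i1 &
          exists2 r : rat, (N0 <= rden r)%N &
            forall x, v j <= x <= v j + l' -> `|x - ratr r| <= 2 * psi (rden r)]) /\
      (forall j k, (j < k)%N -> (k < m)%N ->
        (k - j)%:R * l / (16 * m%:R) <= v k - (v j + l'))].
Proof.
move=> tau2 b1 tau1t btau1 d0 btd c0 c4 psi_ge psi_mono psi_le z l i0 N0 l0 I0i0 il zi0.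
have bt1 : 1 + b < tau1 by nra.
have bt3 : tau1 <= b * tau by nra.
have b0 : 0 <= b by lra.
have tau0 : 0 < tau by lra.
have bt2 : 1 < b * tau / 2 by rewrite ltr_pdivlMr//; nra.
have z0 : 0 < z by rewrite powR_gt0.
have z41 : 4 * z < 1.
  have -> : 4 * z = 2 `^ (1 - b).
    rewrite (_ : 4 = 2 `^ 2%:R) -?powR2D; first by congr (_ `^ _); ring.
    by rewrite powR_mulrn// -natrX.
  rewrite -[ltRHS](powRr0 2) /powR !gt_eqF// ltr_expR ltr_pM2r ?ln_gt0 ?ltr1n//; lra.
have zE i : z ^+ i = 2 `^ (- (1 + b) * i%:R) by rewrite powR2_exprn.
have psi0 : 0 < c * psi (2 ^ i0)%N.
  have i00 : (0 < 2 ^ i0)%N by rewrite expn_gt0.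
  by rewrite mulr_gt0//; apply: lt_le_trans (psi_ge _ i00); rewrite powR_gt0 ?ltr0n.
(* The five thresholds serve in turn: psi(Q) small against z^n; 2 psi(Q) at most half of the gap
   between two fractions; 2/W below the distance to fractions with denominators below 2^i0; at least
   two children; m l'^d >= 1. *)
have [n1 P1] := @powR2_large R (tau1 - 1 - b) 20 ltac:(lra).
have [n2 P2] := @powR2_large R (tau1 - 1 - b * tau / 2) 8 ltac:(lra).
have [n3 P3] := @powR2_large R b (2 / (c * psi (2 ^ i0)%N)) ltac:(lra).
have [n4 P4] := @powR2_large R (1 + b) (48 / l) ltac:(lra).
have [n5 P5] := @powR2_large R (1 + b - b * tau * d) (48 / l) ltac:(lra).
pose ns := [:: i0; N0; n1; n2; n3; n4; n5].
pose n := \max_(k <- ns) k.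
have nP k : k \in ns -> (k <= n)%N by move=> kns; apply: (leq_bigmax_seq k).
have {}P1 := P1 n ltac:(by apply: nP; rewrite !inE eqxx ?orbT).
have {}P2 := P2 n ltac:(by apply: nP; rewrite !inE eqxx ?orbT).
have {}P3 := P3 n ltac:(by apply: nP; rewrite !inE eqxx ?orbT).
have {}P4 := P4 n ltac:(by apply: nP; rewrite !inE eqxx ?orbT).
have {}P5 := P5 n ltac:(by apply: nP; rewrite !inE eqxx ?orbT).
have i0n : (i0 <= n)%N by apply: nP; rewrite !inE eqxx ?orbT.
have N0n : (N0 <= n)%N by apply: nP; rewrite !inE eqxx ?orbT.
clearbody n; clear n1 n2 n3 n4 n5 ns nP.
have zn0 : 0 < z ^+ n by rewrite exprn_gt0.
have zn2 e : z ^+ n * 2 `^ ((1 + b + e) * n%:R) = 2 `^ (e * n%:R).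
  by rewrite zE -powR2D; congr (_ `^ _); ring.
have N1 : 20 * 2 `^ (- (n%:R * tau1)) <= z ^+ n.
  rewrite -(@ler_pM2r _ (2 `^ (n%:R * tau1))) ?powR_gt0// -mulrA -powR2D addNr powRr0 mulr1.
  apply: le_trans P1 _; rewrite -zn2 ler_pM2l//; apply: ler_powR2; lra.
(* This is the least natural number above b n tau / 2: 4^i1 l' exceeds 1, while 2^i1 is at most
   twice l'^(-1/2). *)
pose i1 := (Num.truncn (b * n%:R * tau / 2)).+1.
have bnt0 : 0 <= b * n%:R * tau / 2 by rewrite divr_ge0 ?mulr_ge0// ltW.
have /andP[i1lo i1hi] := truncn_itv bnt0; rewrite -/i1 in i1hi.
have i1lo' : i1%:R <= b * n%:R * tau / 2 + 1 by rewrite /i1 -natr1 lerD2r.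
have N2 : 4 * (2 ^ i1)%:R * 2 `^ (n%:R * (1 - tau1)) <= 1.
  rewrite -(@ler_pM2r _ (2 `^ ((tau1 - 1 - b * tau / 2) * n%:R))) ?powR_gt0// mul1r.
  apply: le_trans P2; rewrite -!mulrA -powR2D natr_pow2 -powR2D.
  rewrite (_ : 8 = 4 * 2 `^ 1); last by rewrite powRr1// -natrM.
  by rewrite ler_pM2l//; apply: ler_powR2; lra.
pose l' := 2 `^ (- (b * n%:R * tau)) : R.
have l'0 : 0 < l' by rewrite powR_gt0.
have l'z : l' <= z ^+ n / 20.
  rewrite ler_pdivlMr// mulrC; apply: le_trans N1; rewrite ler_pM2l//.
  apply: ler_powR2; by rewrite lerN2 mulrC mulrAC ler_wpM2r.
have zl : 48 * z ^+ n <= l.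
  rewrite mulrC -ler_pdivlMr//; rewrite -(@ler_pM2r _ (2 `^ ((1 + b) * n%:R))) ?powR_gt0//.
  have := zn2 0; rewrite addr0 mul0r powRr0 => ->.
  have -> : l / 48 = (48 / l)^-1 by rewrite invf_div.
  by rewrite mulrC ler_pdivlMr ?divr_gt0// mul1r.
pose m := Num.truncn (l / (24 * z ^+ n)).
have lz2 : 2 <= l / (24 * z ^+ n).
  by rewrite ler_pdivlMr ?mulr_gt0// mulrA -natrM.
have /andP[m1 m2] := truncn_itv (le_trans (ler0n _ 2) lz2); rewrite -/m in m1 m2.
have m2n : (2 <= m)%N by rewrite /m truncn_ge_nat// (le_trans _ lz2).
have m0R : 0 < m%:R :> R by rewrite ltr0n ltnW.
have ml : m%:R * (24 * z ^+ n) <= l by rewrite -ler_pdivlMr ?mulr_gt0.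
have lm : l <= m%:R * (48 * z ^+ n).
  move: m2; rewrite -natr1 ltr_pdivrMr ?mulr_gt0// => /ltW h; apply: le_trans h _.
  have : z ^+ n <= m%:R * z ^+ n by rewrite ler_peMl ?(ltW zn0)// ler1n ltnW.
  by clear; lra.
have ni1 : (n < i1)%N.
  rewrite -(ltr_nat R); apply: le_lt_trans i1hi.
  have -> : b * n%:R * tau / 2 = n%:R * (b * tau / 2) by ring.
  by rewrite ler_peMr// ltW.
have W0 : 0 < 2 `^ (b * n%:R) :> R by rewrite powR_gt0.
exists m, l', i1; split.
- by split=> //; exact: leq_ltn_trans ni1.
- rewrite (_ : 4 = 2 `^ 2%:R); last by rewrite powR_mulrn// -natrX.
  rewrite powR2_exprn -powR2D -[leLHS](powRr0 2); apply: ler_powR2.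
  by move: i1hi; clear; lra.
(* As m is of order l 2^((1+b)n) and l'^d = 2^(-b n tau d), the inequality b tau d < 1 + b makes the
   product large. *)
- rewrite /l' -powRrM.
  apply: (@le_trans _ _ (l / (48 * z ^+ n) * 2 `^ (- (b * n%:R * tau) * d))).
    have -> : l / (48 * z ^+ n) = (48 / l)^-1 * (z ^+ n)^-1.
      by rewrite invf_div invfM mulrA.
    rewrite -[leRHS]mulrA [leRHS]mulrC ler_pdivlMr ?divr_gt0// mul1r; apply: le_trans P5 _.
    by rewrite zE -powRN -powR2D; apply: ler_powR2; clear; lra.
  rewrite ler_pM2r ?powR_gt0// ler_pdivrMr ?mulr_gt0//.
- apply: le_trans zi0; apply: ler_wiXn2l; rewrite ?mulr_ge0 ?(ltW z0) ?(ltW z41)//.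
  by apply: ltnW; exact: leq_ltn_trans ni1.
move=> u uJ.
have zl24 : 24 * z ^+ n <= l by move: zl zn0; clear; lra.
have [G [Gm Ginc Ggood]] := good_grid_points u z0 z41 i0n il zi0 zl24.
rewrite -/m in Gm Ginc Ggood.
pose y j := u + (G j).+1%:R * (8 * z ^+ n).
have yJ j : (j < m)%N -> u + 8 * z ^+ n <= y j <= u + 16 * (m%:R * z ^+ n).
  move=> /Gm jm; rewrite /y !lerD2l.
  have G1 : 1 <= (G j).+1%:R :> R by rewrite ler1n.
  have G2 : (G j).+1%:R <= 2 * m%:R :> R by rewrite -natrM ler_nat.
  apply/andP; split; first by rewrite ler_peMl// mulr_ge0// ltW.
  by have := ler_wpM2r (ltW zn0) G2; clear; lra.
have child j : exists v, (j < m)%N ->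
    [/\ `|v - y j| <= (2 + 20^-1) * z ^+ n,
    exists2 r : rat, (2 ^ n <= rden r)%N &
      forall x, v <= x <= v + l' -> `|x - ratr r| <= 2 * psi (rden r) &
    forall x, v <= x <= v + l' ->
      forall r : rat, (2 ^ i0 <= rden r < 2 ^ i1)%N ->
        psi (rden r) / 4 <= `|x - ratr r|].
  have [jm|] := ltnP j m; last by exists 0.
  have [v vP] : exists v, [/\ `|v - y j| <= (2 + 20^-1) * z ^+ n,
    exists2 r : rat, (2 ^ n <= rden r)%N &
      forall x, v <= x <= v + l' -> `|x - ratr r| <= 2 * psi (rden r) &
    forall x, v <= x <= v + l' ->
      forall r : rat, (2 ^ i0 <= rden r < 2 ^ i1)%N ->
        psi (rden r) / 4 <= `|x - ratr r|]; last by exists v.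
  apply: (approximating_interval (I0 := I0) (tau1 := tau1)) => //.
  - exact: ltW.
  - by rewrite I0i0.
  - exact: Ggood.
  move=> r ri0.
  have yj : u <= y j <= u + l by have /andP[] := yJ _ jm; move: zn0 ml; clear; lra.
  apply: le_trans (uJ _ _ yj ri0).
  apply: (@le_trans _ _ (c * psi (2 ^ i0)%N)).
    by rewrite ler_pdivrMr// mulrC -ler_pdivrMr.
  by rewrite ler_pM2l//; apply: psi_mono; [exact: rden_gt0|exact: ltnW].
have [v vP] := choice child; exists v; split.
  move=> j jm; have [vy [r rn rP] far] := vP _ jm.
  have := yJ _ jm; move: vy; rewrite ler_norml => /andP[vy1 vy2] /andP[yj1 yj2].
  have uv : u <= v j by move: vy1 yj1 zn0; clear; lra.
  have vu : v j + l' <= u + l by move: vy2 yj2 ml zl l'z zn0; clear; lra.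
  split=> //.
    (* Denominators below 2^i0 are inherited from the parent interval; those from 2^i0 to 2^i1 are
       new, and c <= 1/4 matches psi / 4. *)
    move=> x r' xv r'i1; have [r'i0|r'i0] := ltnP (rden r') (2 ^ i0).
      by apply: uJ => //; move: xv uv vu; clear; lra.
    apply: le_trans (far _ xv r' _); last by rewrite r'i0.
    rewrite mulrC; apply: ler_wpM2l => //.
    by apply: le_trans (psi_ge _ (rden_gt0 _)); exact: powR_ge0.
  exists r => //; apply: leq_trans rn; apply: leq_trans N0n _; apply: ltnW.
  exact: ltn_expl.
move=> j k jk km; have jm := ltn_trans jk km.
have [vj _ _] := vP _ jm; have [vk _ _] := vP _ km.
have [Gkj Glt] := Ginc _ _ jk km.
have ykj : (k - j)%:R * (8 * z ^+ n) <= y k - y j.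
  have -> : y k - y j = (G k - G j)%:R * (8 * z ^+ n).
    by rewrite /y natrB ?(ltnW Glt)// -!natr1; ring.
  by rewrite ler_pM2r ?mulr_gt0// ler_nat.
have kj1 : 1 <= (k - j)%:R :> R by rewrite ler1n subn_gt0.
(* Grid points are 8 z^n apart, each child starts within 2.05 z^n of its grid point and has length
   at most z^n / 20, so a gap of 3 z^n per index remains. *)
have lm3 : l / (16 * m%:R) <= 3 * z ^+ n.
  rewrite ler_pdivrMr; last by rewrite mulr_gt0.
  by apply: le_trans lm _; rewrite le_eqVlt; apply/orP; left; apply/eqP; ring.
rewrite -mulrA.
apply: (@le_trans _ _ ((k - j)%:R * (3 * z ^+ n))).
  by apply: ler_wpM2l lm3; exact: ler0n.
move: vj vk; rewrite !ler_norml => /andP[vj1 vj2] /andP[vk1 vk2].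
have : z ^+ n <= (k - j)%:R * z ^+ n by rewrite ler_peMl// ltW.
by move: vj1 vj2 vk1 vk2 ykj l'z zn0; clear; lra.
Qed.

(** * Mixed radix parametrization of a Cantor set *)

Lemma truncn_mulr_divn (R : realType) (x : R) (m : nat) : 0 <= x -> (0 < m)%N ->
  (Num.truncn (x * m%:R) %/ m)%N = Num.truncn x.
Proof.
move=> x0 m0; have mR : 0 < m%:R :> R by rewrite ltr0n.
have /andP[x1 x2] := truncn_itv x0.
have xm0 : 0 <= x * m%:R by rewrite mulr_ge0.
have /andP[y1 y2] := truncn_itv xm0.
apply/eqP; rewrite eqn_leq -ltnS ltn_divLR// leq_divRL//; apply/andP; split.
  rewrite -(ltr_nat R); apply: le_lt_trans y1 _.
  by rewrite natrM ltr_pM2r.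
rewrite truncn_ge_nat// natrM ler_pM2r//.
Qed.

(* f sends a to the point of the decreasing sequence of intervals [u, u + L k]
   selected by the digits of a in the mixed radix system of bases m 0, m 1, etc. *)
Lemma cantor_scheme (R : realType) (d u0 : R) (L : nat -> R) (m : nat -> nat)
    (step : nat -> R -> nat -> R) (Good : nat -> R -> Prop) :
  0 < d -> d <= 1 -> (forall k, 0 < L k) -> L 0%N <= 1 -> (forall k, (2 <= m k)%N) ->
  (forall k, 1 <= (m k)%:R * L k.+1 `^ d) ->
  Good 0%N u0 ->
  (forall k u j, Good k u -> (j < m k)%N ->
     [/\ Good k.+1 (step k u j), u <= step k u j & step k u j + L k.+1 <= u + L k]) ->
  (forall k u i j, Good k u -> (i < j)%N -> (j < m k)%N ->
     (j - i)%:R * L k / (16 * (m k)%:R) <= step k u j - (step k u i + L k.+1)) ->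
  exists (f : R -> R) (C : R), [/\ 0 < C,
    forall a : R, 0 <= a < 1 -> exists us : nat -> R, us 0%N = u0 /\
      forall k, [/\ Good k (us k),
        exists2 j, (j < m k)%N & us k.+1 = step k (us k) j & us k <= f a <= us k + L k] &
    forall a b : R, 0 <= a < 1 -> 0 <= b < 1 -> `|a - b| <= C * `|f a - f b| `^ d].
Proof.
move=> d0 d1 L0 L01 m2 mL G0 Gstep sep.
have m0 k : (0 < m k)%N by apply: ltnW.
have mR k : 0 < (m k)%:R :> R by rewrite ltr0n.
pose N k := (\prod_(i < k) m i)%N.
have NS k : N k.+1 = (N k * m k)%N by rewrite /N big_ord_recr.
have N0 k : (0 < N k)%N by apply: prodn_gt0.
have NR k : 0 < (N k)%:R :> R by rewrite ltr0n.
have N2 k : (2 ^ k <= N k)%N.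
  by elim: k => [|k IH]; rewrite ?N0// NS expnSr leq_mul.
(* [c a k] is the index of the cell containing a when [0, 1[ is cut into [N k] equal cells;
   [dig a k] is the last digit of [c a k.+1]. *)
pose c (a : R) k := Num.truncn (a * (N k)%:R).
have cP a k : 0 <= a -> (c a k)%:R <= a * (N k)%:R < (c a k).+1%:R.
  by move=> a0; apply: truncn_itv; rewrite mulr_ge0.
have cS a k : 0 <= a -> (c a k.+1 %/ m k)%N = c a k.
  by move=> a0; rewrite /c NS natrM mulrA truncn_mulr_divn// mulr_ge0.
pose dig a k := (c a k.+1 %% m k)%N.
have digm a k : (dig a k < m k)%N by rewrite ltn_mod.
pose pos a := fix pos k := if k is k'.+1 then step k' (pos k') (dig a k') else u0.
have posG a k : Good k (pos a k).
  by elim: k => //= k IH; have [] := Gstep _ _ _ IH (digm a k).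
have posS a k : pos a k <= pos a k.+1 /\ pos a k.+1 + L k.+1 <= pos a k + L k.
  by have [] := Gstep _ _ _ (posG a k) (digm a k).
have pos_le a i n : pos a i <= pos a (i + n)%N /\ pos a (i + n)%N + L (i + n)%N <= pos a i + L i.
  elim: n => [|n [IH1 IH2]]; first by rewrite addn0.
  rewrite addnS; have [h1 h2] := posS a (i + n)%N.
  by split; [exact: le_trans h1|exact: le_trans IH2].
have pos_bd a i k : pos a i <= pos a k + L k.
  have [ik|ki] := leqP i k.
    have [h _] := pos_le a i (k - i)%N; rewrite subnKC// in h.
    by apply: le_trans h _; rewrite lerDl ltW.
  have [_ h] := pos_le a k (i - k)%N; rewrite subnKC ?(ltnW ki)// in h.
  by apply: le_trans h; rewrite lerDl ltW.
pose f a := sup (range (pos a)).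
have fP a k : pos a k <= f a <= pos a k + L k.
  apply/andP; split.
    apply: ub_le_sup; last by exists k.
    by exists (pos a 0%N + L 0%N) => _ [i _ <-]; exact: pos_bd.
  apply: ge_sup; first by exists (pos a 0%N); exists 0%N.
  by move=> _ [i _ <-]; exact: pos_bd.
have cpos a b k : 0 <= a -> 0 <= b -> c a k = c b k -> pos a k = pos b k.
  move=> a0 b0; elim: k => // k IH cab.
  have ck : c a k = c b k by rewrite -cS// cab cS.
  by rewrite /= IH// /dig cab.
(* From level 1 on, N_k L_k^d >= 1; the value L_0^d, which is at most 1, covers level 0 as well. *)
pose kappa := L 0%N `^ d.
have k0 : 0 < kappa by rewrite powR_gt0.
have Lk k : kappa <= (N k)%:R * L k `^ d.
  case: k => [|k]; first by rewrite /N big_ord0 mul1r.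
  apply: (@le_trans _ _ 1).
    rewrite -[leRHS](_ : 1 `^ d = 1); last by rewrite powR1.
    by apply: ge0_ler_powR; rewrite ?nnegrE ?ler01 ?(ltW (L0 _)) ?(ltW d0).
  rewrite NS natrM -mulrA -[leLHS]mul1r; apply: ler_pM => //.
  by rewrite ler1n.
exists f, (32 / kappa); split.
- by rewrite divr_gt0.
- move=> a a01; exists (pos a); split=> // k; split=> //.
  by exists (dig a k).
suff holder a b : 0 <= a < 1 -> 0 <= b < 1 -> a < b ->
    b - a <= 32 / kappa * `|f a - f b| `^ d.
  move=> a b a01 b01; have [ab|ba|->] := ltgtP a b.
  - by rewrite ler0_norm ?opprB ?holder// subr_le0 ltW.
  - by rewrite ger0_norm ?[`|f a - _|]distrC ?holder// subr_ge0 ltW.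
  - by rewrite subrr normr0 mulr_ge0 ?powR_ge0// divr_ge0// ltW.
move=> /andP[a0 a1] /andP[b0 b1] ab.
have ba0 : 0 < b - a by rewrite subr_gt0.
(* As N_k >= 2^k, the cells of a and b differ once 2^k exceeds 1/(b - a); the separation of f a and
   f b is read off at the first such level. *)
have ex : exists k, c a k != c b k.
  pose k := (Num.truncn (b - a)^-1).+1; exists k; apply/eqP => cab.
  have /andP[_ h] := truncn_itv (ltW (etrans (invr_gt0 (b - a)) ba0)).
  have /andP[h1 h2] := cP a k a0; have /andP[h3 h4] := cP b k b0.
  rewrite cab -natr1 in h1 h2; rewrite -natr1 in h4.
  have : (b - a) * (N k)%:R < 1 by rewrite mulrBl; lra.
  apply/negP; rewrite -leNgt mulrC -ler_pdivrMr// mul1r.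
  apply: le_trans (ltW h) _; rewrite ler_nat -/k.
  by apply: leq_trans (ltnW (ltn_expl k _)) (N2 k).
have [K cK Kmin] := ex_minnP ex.
case: K cK Kmin => [|k] cK Kmin.
  have c0 x : 0 <= x < 1 -> c x 0%N = 0%N.
    by move=> x01; apply: truncn_def; rewrite /N big_ord0 mulr1.
  by rewrite !c0 ?a0 ?b0 ?eqxx in cK.
have ck : c a k = c b k.
  by apply/eqP; apply: contraT => /Kmin; rewrite ltnn.
have dd : (dig a k < dig b k)%N.
  have := divn_eq (c a k.+1) (m k); have := divn_eq (c b k.+1) (m k).
  rewrite !cS// ck -/(dig a k) -/(dig b k) => eb ea.
  have : (c a k.+1 <= c b k.+1)%N.
    by apply: le_truncn; rewrite ler_pM2r// ltW.
  move: cK; rewrite ea eb leq_add2l eqn_add2l => ne le.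
  by rewrite ltn_neqAle ne.
set D := (dig b k - dig a k)%N.
have D1 : 1 <= D%:R :> R by rewrite ler1n subn_gt0.
have Dm : D%:R <= (m k)%:R :> R.
  by rewrite ler_nat (leq_trans (leq_subr _ _))// ltnW.
have pk := cpos _ _ k a0 b0 ck.
have fD : D%:R * L k / (16 * (m k)%:R) <= `|f a - f b|.
  rewrite distrC; apply: le_trans (ler_norm _).
  have /andP[_ fa] := fP a k.+1; have /andP[fb _] := fP b k.+1.
  have := sep _ _ _ _ (posG a k) dd (digm b k).
  by move: fa fb; rewrite /= -pk -/D; lra.
have baD : (b - a) * ((N k)%:R * (m k)%:R) <= 2 * D%:R.
  have /andP[h1 h2] := cP a k.+1 a0; have /andP[h3 h4] := cP b k.+1 b0.
  rewrite -natrM -NS mulrBl.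
  have cab : (c b k.+1)%:R - (c a k.+1)%:R = D%:R :> R.
    rewrite (divn_eq (c a k.+1) (m k)) (divn_eq (c b k.+1) (m k)) !cS// ck.
    by rewrite /D natrB ?(ltnW dd)// !natrD; ring.
  by rewrite -natr1 in h4; lra.
have Dm0 : 0 < D%:R / (m k)%:R :> R by rewrite divr_gt0//; lra.
have Ld0 : 0 < L k `^ d by rewrite powR_gt0.
(* Raising D/m and 1/16 to the power d only increases them, as d and both numbers are at most 1. The
   constant 32 is 2 * 16, the 2 coming from b - a <= 2 D / (N m). *)
have pw : D%:R / (m k)%:R * (L k `^ d / 16) <= `|f a - f b| `^ d.
  apply: (@le_trans _ _ ((D%:R * L k / (16 * (m k)%:R)) `^ d)).
    have -> : D%:R * L k / (16 * (m k)%:R) = D%:R / (m k)%:R * (L k * 16^-1).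
      by field; rewrite gt_eqF.
    rewrite powRM ?(ltW Dm0) ?mulr_ge0 ?(ltW (L0 k))// powRM ?(ltW (L0 k))//.
    apply: ler_pM; rewrite ?(ltW Dm0) ?divr_ge0 ?(ltW Ld0)//.
      by apply: ger1_powR => //; rewrite Dm0/= ler_pdivrMr// mul1r.
    rewrite ler_pM2l//; apply: ger1_powR => //; lra.
  apply: ge0_ler_powR; rewrite ?nnegrE ?(ltW d0)//.
  by rewrite divr_ge0 ?mulr_ge0 ?(ltW (L0 k)) ?(ltW (mR k)).
rewrite mulrAC ler_pdivlMr//.
apply: (@le_trans _ _ (32 * (D%:R / (m k)%:R * (L k `^ d / 16)))); last by rewrite ler_pM2l.
apply: (@le_trans _ _ ((b - a) * ((N k)%:R * L k `^ d))); first by rewrite ler_pM2l.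
have -> : 32 * (D%:R / (m k)%:R * (L k `^ d / 16)) = 2 * D%:R * (L k `^ d / (m k)%:R).
  by field; rewrite gt_eqF.
have -> : (b - a) * ((N k)%:R * L k `^ d) =
    (b - a) * ((N k)%:R * (m k)%:R) * (L k `^ d / (m k)%:R).
  by field; rewrite gt_eqF.
by rewrite ler_pM2r// divr_gt0.
Qed.

(** With e = 4^(-i), rationals r <= 0 are at distance at least e from [e, 2e], and positive ones
    satisfy r >= 1/q >= 4e because q < 2^i and i >= 2. *)
Lemma avoids_initial (R : realType) (psi : nat -> R) (c : R) (i : nat) :
  (2 <= i)%N -> 0 <= c ->
  (forall p q, (0 < p)%N -> (p <= q)%N -> psi q <= psi p) ->
  c * psi 1%N <= (4 ^+ i)^-1 ->
  avoids psi c (4 ^+ i)^-1 (4 ^+ i)^-1 i.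
Proof.
move=> i2 c0 psi_mono cpsi x r xI ri.
apply: (@le_trans _ _ (4 ^+ i)^-1).
  by apply: le_trans cpsi; rewrite ler_wpM2l// psi_mono// rden_gt0.
have e0 : 0 < (4 ^+ i)^-1 :> R by rewrite invr_gt0 exprn_gt0.
have [r0|r0] := leP (ratr r : R) 0.
  by apply: le_trans (ler_norm _); lra.
have q0 := rden_gt0R R r.
have rq : (rden r)%:R^-1 <= ratr r :> R.
  rewrite ratr_num_den ler_peMl ?invr_ge0 ?(ltW q0)// ler1z -gtz0_ge1.
  by rewrite -(ltr0z R) numq_ratr mulr_gt0.
have : 4 * (4 ^+ i)^-1 <= (rden r)%:R^-1 :> R.
  rewrite -[leRHS]mul1r ler_pdivlMr// mulrAC ler_pdivrMr ?exprn_gt0// mul1r.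
  apply: (@le_trans _ _ ((2 ^ 2)%:R * (2 ^ i)%:R)).
    by rewrite ler_pM// ler_nat// ltnW.
  by rewrite -natrM -natrX ler_nat (_ : 4 = 2 * 2)%N// expnMn leq_mul2r leq_exp2l// i2 orbT.
move=> h; apply: le_trans (_ : ratr r - x <= _); first by lra.
by rewrite distrC; exact: ler_norm.
Qed.

Lemma approximable_holder (R : realType) (psi : nat -> R) (tau d : R) :
  2 < tau ->
  (forall q, (0 < q)%N -> q%:R `^ (- tau) <= psi q) ->
  (forall p q, (0 < p)%N -> (p <= q)%N -> psi q <= psi p) ->
  (forall sigma, sigma < tau -> exists N, forall q, (N <= q)%N ->
     2 * psi q < q%:R `^ (- sigma)) ->
  0 < d -> d < 2 / tau ->
  exists (f : R -> R) (C : R), [/\ 0 < C,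
    forall a : R, 0 <= a < 1 -> approximable psi (f a) /\ 0 <= f a <= 1 &
    forall a b : R, 0 <= a < 1 -> 0 <= b < 1 -> `|a - b| <= C * `|f a - f b| `^ d].
Proof.
move=> tau2 psi_ge psi_mono psi_lt d0 dtau.
have dt : d * tau < 2 by rewrite -ltr_pdivlMr//; lra.
have d1 : d <= 1 by nra.
have [b [b1 bt btd]] : exists b, [/\ 1 < b, b * (tau / 2 + 1) < tau & b * tau * d < 1 + b].
  (* At b = 1 the two upper constraints read tau / 2 + 1 < tau and tau d < 2, which hold strictly;
     the two arguments of the minimum keep them true for b = 1 + e. *)
  pose e := Num.min ((tau / 2 - 1) / (2 * (tau / 2 + 1))) ((2 - d * tau) / 2).
  have t1 : 0 < 2 * (tau / 2 + 1) by lra.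
  have e0 : 0 < e by rewrite lt_min divr_gt0//=; lra.
  have e1 : e * (2 * (tau / 2 + 1)) <= tau / 2 - 1.
    by rewrite -ler_pdivlMr// ge_min lexx.
  have e2 : e <= (2 - d * tau) / 2 by rewrite ge_min lexx orbT.
  exists (1 + e); split; first by rewrite ltrDl.
    by nra.
  have -> : (1 + e) * tau * d = d * tau + e * (d * tau) by ring.
  by nra.
pose tau1 := (b * (tau / 2 + 1) + tau) / 2.
have tau1lt : tau1 < tau by rewrite /tau1; lra.
have btau1 : b * (tau / 2 + 1) < tau1 by rewrite /tau1; lra.
have [I0 I0P] := psi_lt _ tau1lt.
have psi_pos q : (0 < q)%N -> 0 < psi q.
  by move=> q0; apply: lt_le_trans (psi_ge _ q0); rewrite powR_gt0 ?ltr0n.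
have psi_le q : (2 ^ I0 <= q)%N -> psi q <= q%:R `^ (- tau1).
  move=> qI; have q0 : (0 < q)%N by apply: leq_trans qI; rewrite expn_gt0.
  have := I0P q (leq_trans (ltnW (ltn_expl I0 (leqnn 2))) qI).
  by have := psi_pos _ q0; lra.
pose z : R := 2 `^ (- (1 + b)).
have zE i : (4 * z) ^+ i = 2 `^ ((1 - b) * i%:R).
  rewrite -powR2_exprn; congr (_ ^+ _).
  rewrite /z (_ : 4 = 2 `^ 2%:R); last by rewrite powR_mulrn// -natrX.
  by rewrite -powR2D; congr (_ `^ _); ring.
have z41 : 4 * z < 1.
  rewrite -[ltLHS]expr1 zE mulr1 -[ltRHS](powRr0 2) /powR !gt_eqF//.
  rewrite ltr_expR ltr_pM2r ?ln_gt0 ?ltr1n//; lra.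
have [n1 n1P] := @powR2_large R (b - 1) (3000 / (1 - 4 * z)) ltac:(lra).
pose i0 := (maxn n1 (maxn I0 2)).
have zi0 : (4 * z) ^+ i0 <= (1 - 4 * z) / 3000.
  have := n1P i0 (leq_maxl _ _); rewrite zE (_ : (1 - b) * i0%:R = - ((b - 1) * i0%:R)); last by ring.
  rewrite powRN.
  have K0 : 0 < 3000 :> R by rewrite ltr0n.
  move: (3000 : R) K0 => K K0.
  have h : 0 < K / (1 - 4 * z) by apply: divr_gt0 K0 _; rewrite subr_gt0.
  move=> Kle; rewrite -[leRHS]invf_div lef_pV2 ?posrE ?powR_gt0//.
have I0i0 : (I0 <= i0)%N by rewrite /i0 !leq_max leqnn orbT.
have i02 : (2 <= i0)%N by rewrite /i0 !leq_max leqnn !orbT.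
(* The bound 1/4 is for the inductive stage, the other one for the initial interval. *)
pose c := Num.min 4^-1 ((4 ^+ i0)^-1 / psi 1%N).
have c0 : 0 < c by rewrite lt_min invr_gt0 ltr0n/= divr_gt0 ?invr_gt0 ?exprn_gt0 ?psi_pos.
have c4 : c <= 4^-1 by rewrite ge_min lexx.
have stage := cantor_stage (I0 := I0) tau2 b1 tau1lt btau1 d0 btd c0 c4 psi_ge psi_mono psi_le.
rewrite -/z /= in stage.
pose Inv (p : R * nat) := [/\ 0 < p.1, (I0 <= p.2)%N, 1 <= 4 ^+ p.2 * p.1 &
  (4 * z) ^+ p.2 <= (1 - 4 * z) / 3000].
pose child (p : R * nat) (N0 : nat) (o : nat * (R * nat)) u v :=
  (forall j, (j < o.1)%N ->
    [/\ u <= v j, v j + o.2.1 <= u + p.1, avoids psi c (v j) o.2.1 o.2.2 &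
      exists2 r : rat, (N0 <= rden r)%N &
        forall x, v j <= x <= v j + o.2.1 -> `|x - ratr r| <= 2 * psi (rden r)]) /\
  (forall j k, (j < k)%N -> (k < o.1)%N ->
    (k - j)%:R * p.1 / (16 * o.1%:R) <= v k - (v j + o.2.1)).
pose next (x : (R * nat) * nat) (o : nat * (R * nat)) := Inv x.1 ->
    [/\ (2 <= o.1)%N, (x.1.2 < o.2.2)%N, 1 <= o.1%:R * o.2.1 `^ d,
      Inv o.2 & forall u, avoids psi c u x.1.1 x.1.2 -> exists v, child x.1 x.2 o u v].
(* [next] has the invariant as a premise, so a choice function exists on all states, with arbitrary
   values off the invariant. Its choices do not depend on the interval's position u. *)
have /choice[F FP] : forall x, exists o, next x o.
  move=> [[l i] N0]; rewrite /next /=.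
  have [[l0 iI il zi]|nI] := pselect (Inv (l, i)); last by exists (0%N, (0, 0%N)).
  have [m [l' [i1 [[m2 l'0 ii1] i1l md zi1 ch]]]] := stage l i N0 l0 iI il zi.
  exists (m, (l', i1)) => _; split=> //; split=> //=.
  by apply: ltnW; exact: leq_ltn_trans ii1.
have e0 : 0 < (4 ^+ i0)^-1 :> R by rewrite invr_gt0 exprn_gt0.
(* At level k the lower bound asked of the approximating denominators is k itself, so they are
   unbounded along the levels. *)
pose st := fix st k : R * nat := if k is k'.+1 then (F (st k', k')).2
  else ((4 ^+ i0)^-1, i0).
have stI k : Inv (st k).
  elim: k => [|k IH]; last by have [] := FP (st k, k) IH.
  by split; rewrite //= divff// gt_eqF// exprn_gt0.
have sti k : (k <= (st k).2)%N.
  elim: k => // k IH; have [_ h _ _ _] := FP (st k, k) (stI k).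
  exact: leq_ltn_trans h.
pose steps (x : nat * R) (v : nat -> R) := avoids psi c x.2 (st x.1).1 (st x.1).2 ->
    child (st x.1) x.1 (F (st x.1, x.1)) x.2 v.
have /choice[step stepP] : forall x, exists v, steps x v.
  move=> [k u]; rewrite /steps /=; have [_ _ _ _ h] := FP (st k, k) (stI k).
  have [av|nav] := pselect (avoids psi c u (st k).1 (st k).2); last by exists (fun=> 0).
  by have [v vP] := h _ av; exists v.
have e4 : (4 ^+ i0)^-1 <= 4^-1 :> R.
  rewrite lef_pV2 ?posrE ?exprn_gt0// -[leLHS]expr1.
  by apply: ler_weXn2l; [rewrite ler1n|exact: ltnW].
have [|||||||f [C [C0 fP fC]]] := @cantor_scheme R d (4 ^+ i0)^-1 (fun k => (st k).1)
    (fun k => (F (st k, k)).1) (fun k u => step (k, u))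
    (fun k u => avoids psi c u (st k).1 (st k).2) d0 d1.
- by move=> k; have [] := stI k.
- by move: e4; clear; rewrite /=; lra.
- by move=> k; have [] := FP (st k, k) (stI k).
- by move=> k; have [] := FP (st k, k) (stI k).
- apply: avoids_initial => //; first exact: ltW.
  by rewrite -ler_pdivlMr ?psi_pos// ge_min lexx orbT.
- by move=> k u j av jm; have [/(_ j jm)[]] := stepP (k, u) av.
- by move=> k u i j av ij jm; have [_] := stepP (k, u) av; exact.
exists f, C; split=> // a a01.
have [us [us0 usP]] := fP a a01.
split; last by have [_ _] := usP 0%N; rewrite us0 /=; move: e0 e4; clear; lra.
split.
  (* At level q = [rden r] the stage exponent is at least q, and q < 2^q, so [avoids] already
     applies to r. *)
  exists c => // r; have [av _ fI] := usP (rden r).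
  apply: av => //; apply: leq_trans (ltn_expl _ (leqnn 2)) _.
  by rewrite leq_exp2l.
move=> N; have [av [j jm usS] _] := usP N; have [_ _ fI] := usP N.+1.
have [/(_ j jm)[_ _ _ [r rN rP]] _] := stepP (N, us N) av.
by exists r => //; apply: rP; move: fI; rewrite usS.
Qed.

(** * The three dimensions *)

Lemma hausdorff_dim_approximable (R : realType) (psi : nat -> R) (tau : R)
    (A : set R) : 2 < tau ->
  (forall q, (0 < q)%N -> q%:R `^ (- tau) <= psi q) ->
  (forall p q, (0 < p)%N -> (p <= q)%N -> psi q <= psi p) ->
  (forall sigma, sigma < tau -> exists N, forall q, (N <= q)%N ->
     2 * psi q < q%:R `^ (- sigma)) ->
  approximable psi `<=` A -> A `<=` exact_exponent_set tau ->
  hausdorff_dim A = (2 / tau)%:E.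
Proof.
move=> tau2 psi_ge psi_mono psi_lt psiA Aexact; have tau0 : 0 < tau by lra.
apply/eqP; rewrite eq_le; apply/andP; split.
  apply: hausdorff_dim_le => [|s ts]; first by rewrite divr_ge0// ltW.
  exact: hausdorff_measure_subset0 Aexact (exact_exponent_set_null tau0 ts).
apply: hausdorff_dim_ge => d d0 dtau.
have [f [C [C0 fP fC]]] := approximable_holder tau2 psi_ge psi_mono psi_lt d0 dtau.
exists f, C; split=> // a a01; have [xa f01] := fP a a01.
by split=> //; exact: psiA.
Qed.

(** Half of the margin tau - sigma absorbs the logarithm, through e ln q <= q^e, and the other half
    absorbs the constant [M]. *)
Lemma psi_log_lt (R : realType) (tau sigma : R) : 1 < tau -> sigma < tau ->
  exists N, forall q, (N <= q)%N -> 2 * psi_log tau q < q%:R `^ (- sigma).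
Proof.
move=> tau1 st; pose e := (tau - sigma) / 2.
have e0 : 0 < e by rewrite divr_gt0// subr_gt0.
pose M := 2 * (1 + (tau - 1) / e).
have M0 : 0 < M by rewrite mulr_gt0// addr_gt0// divr_gt0// subr_gt0.
exists (Num.truncn (M `^ e^-1)).+1 => q qN.
have q0 : 0 < q%:R :> R by rewrite ltr0n; apply: leq_trans qN.
have q1 : 1 <= q%:R :> R by rewrite ler1n; apply: leq_trans qN.
have Mq : M < q%:R `^ e.
  have h : M `^ e^-1 < q%:R.
    have /andP[_ h] := truncn_itv (powR_ge0 M e^-1).
    by apply: lt_le_trans h _; rewrite ler_nat.
  have -> : M = (M `^ e^-1) `^ e.
    by rewrite -powRrM mulVf ?gt_eqF// powRr1// ltW.
  by apply: gt0_ltr_powR; rewrite ?nnegrE ?powR_ge0 ?(ltW q0).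
have qe0 : 0 < q%:R `^ e by rewrite powR_gt0.
have qe1 : 1 <= q%:R `^ e by rewrite -[leLHS](powRr0 q%:R); apply: ler_powR => //; exact: ltW.
have lnq : ln q%:R <= q%:R `^ e / e.
  rewrite ler_pdivlMr// mulrC -ln_powR; apply: ltW; exact: ln_sublinear.
rewrite /psi_log mulrCA (_ : - sigma = - tau + (e + e)); last by rewrite /e; field.
rewrite !powRD ?(gt_eqF q0) ?implybT// ltr_pM2l ?powR_gt0//.
apply: (@le_lt_trans _ _ (M * q%:R `^ e)); last by rewrite ltr_pM2r.
have := ler_wpM2l (ltW (etrans (subr_gt0 1 tau) tau1)) lnq.
rewrite /M; have -> : (tau - 1) * (q%:R `^ e / e) = (tau - 1) / e * q%:R `^ e by ring.
by lra.
Qed.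

Lemma powRN_lt (R : realType) (tau sigma : R) : sigma < tau ->
  exists N : nat, forall q : nat, (N <= q)%N ->
    2 * q%:R `^ (- tau) < q%:R `^ (- sigma).
Proof.
move=> st; have e0 : 0 < tau - sigma by rewrite subr_gt0.
exists (Num.truncn (2 `^ (tau - sigma)^-1 : R)).+1 => q qN.
have q0 : 0 < q%:R :> R by rewrite ltr0n; apply: leq_trans qN.
have h : 2 `^ (tau - sigma)^-1 < q%:R :> R.
  have /andP[_ h] := truncn_itv (powR_ge0 (2 : R) (tau - sigma)^-1).
  by apply: lt_le_trans h _; rewrite ler_nat.
rewrite (_ : - sigma = - tau + (tau - sigma)); last by ring.
rewrite powRD ?(gt_eqF q0) ?implybT// mulrC ltr_pM2l ?powR_gt0//.
have -> : 2 = (2 `^ (tau - sigma)^-1) `^ (tau - sigma) :> R.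
  by rewrite -powRrM mulVf ?gt_eqF// powRr1.
by apply: gt0_ltr_powR; rewrite ?nnegrE ?powR_ge0 ?(ltW q0).
Qed.

Theorem corollary7p6 (R : realType) (t tau s : R)
    (ht : 1 < t) (htau : 2 < tau) (hs : s = t * (tau - 1)) :
  [/\ hausdorff_dim (convergence_set s t tau) = (2 / tau)%:E,
      hausdorff_dim (divergence_set s t tau) = (2 / tau)%:E
    & hausdorff_dim (exact_exponent_set tau) = (2 / tau)%:E].
Proof.
have tau1 : 1 < tau by lra.
have tau0 : 0 < tau by lra.
have log_ge q : (0 < q)%N -> q%:R `^ (- tau) <= psi_log tau q := psi_log_ge tau1.
have log_le p q : (0 < p)%N -> (p <= q)%N -> psi_log tau q <= psi_log tau p :=
  psi_log_le tau1.
have log_lt sigma : sigma < tau -> exists N, forall q, (N <= q)%N ->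
    2 * psi_log tau q < q%:R `^ (- sigma) := psi_log_lt tau1.
have pow_le p q : (0 < p)%N -> (p <= q)%N -> q%:R `^ (- tau) <= p%:R `^ (- tau) :> R.
  by move=> p0 pq; apply: ler_powRN; rewrite ?ltr0n ?ler_nat// ltW.
have log_exact x := @approximable_exact _ (psi_log tau) _ x tau0 log_ge log_lt.
have pow_exact x := @approximable_exact _ (fun q => q%:R `^ (- tau)) _ x tau0
  (fun q _ => lexx _) (fun sigma => @powRN_lt _ tau sigma).
split.
- apply: (@hausdorff_dim_approximable _ (psi_log tau)) => // x; last by case.
  move=> xa; have [xirr xtau] := log_exact x xa; split=> //.
  by rewrite hs; exact: flint_hills_psi_log_lty.
- apply: (@hausdorff_dim_approximable _ (fun q => q%:R `^ (- tau))) => //.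
  + by move=> sigma; exact: powRN_lt.
  + move=> x xa; have [xirr xtau] := pow_exact x xa; split=> //.
    by rewrite hs; exact: flint_hills_approximable_pinfty.
  + by move=> x [].
- exact: (@hausdorff_dim_approximable _ (psi_log tau)).
Qed.
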